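(* Let $R$ be a commutative ring, let $S$ be an $R$-algebra (not necessarily commutative), let $K$, $L$, $M$, $N$, $P$ be right $S$-modules, and let $E:=\mathrm{End}_S(N)$ denote the $R$-algebra of all $S$-linear endomorphisms of $N$. Assume the following: (1) $Y:=\mathrm{Max}(R)\cap\mathrm{Supp}_R(N)$ is a finite-dimensional Noetherian subspace of the Zariski space $\mathrm{Spec}(R)$. (2) $N$ is a finitely presented $S$-module, and $E$ is a module-finite $R$-algebra. (3) $P$ is a direct summand of a direct sum of finitely presented right $S$-modules; $P$ is a direct summand of $M$ over $S$; and $N_{\mathfrak m}^{\oplus(1+\dim(Y))}$ is a direct summand of $P_{\mathfrak m}$ over $S_{\mathfrak m}$ for every $\mathfrak m\in Y$. Then $N\oplus L\cong N\oplus M$ implies $L\cong M$. More generally, if $K$ is a direct summand of a direct sum of finitely many copies of $N$ over $S$, then $K\oplus L\cong K\oplus M$ implies $L\cong M$.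
   Context: Rings are associative with unity and modules are unital. An algebra $S$ over a commutative ring $R$ is a ring with a unital ring homomorphism $R\to S$ whose image lies in the center of $S$; it is module-finite if it is finitely generated as an $R$-module. Localizations at a prime $\mathfrak p$ of $R$ are at the multiplicative set $R\setminus\mathfrak p$. $\mathrm{Max}(R)$ is the set of maximal ideals of $R$ with the subspace topology from $\mathrm{Spec}(R)$; $\mathrm{Supp}_R(N)=\{\mathfrak p\in\mathrm{Spec}(R):N_{\mathfrak p}\neq0\}$. A topological space is Noetherian if every descending chain of distinct closed sets has finite length; its (Krull) dimension $\dim$ is the supremum of the lengths of chains of distinct closed irreducible subsets. *)

(* Defs.v *)
From HB Require Import structures.
From mathcomp Require Import all_boot all_order all_algebra generic_quotient.
From mathcomp Require Import all_classical topology.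
From mathcomp Require Import ring.

Set Implicit Arguments.
Unset Strict Implicit.
Unset Printing Implicit Defensive.

Import GRing.Theory.

Local Open Scope classical_set_scope.
Local Open Scope ring_scope.
Local Open Scope quotient_scope.

(* Rings may be zero (pzRingType): MathComp's algType requires 1 != 0, which   *)
(* the endomorphism ring of a zero module violates.                            *)
Record centralAlgType (R : comPzRingType) := CentralAlg {
  alg_sort :> pzRingType;
  alg_map : {rmorphism R -> alg_sort};
  alg_mapC : forall (r : R) (x : alg_sort), alg_map r * x = x * alg_map r
}.

Definition alg_mod (R : comPzRingType) (A : centralAlgType R) : Type := A.

Section AlgebraModule.
Variables (R : comPzRingType) (A : centralAlgType R).

HB.instance Definition _ := GRing.Zmodule.on (alg_mod A).

Definition algZ (r : R) (x : alg_mod A) : alg_mod A := alg_map A r * (x : A).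

Fact algZA a b x : algZ a (algZ b x) = algZ (a * b) x.
Proof. by rewrite /algZ mulrA rmorphM. Qed.
Fact alg1Z : left_id 1 algZ.
Proof. by move=> x; rewrite /algZ rmorph1 mul1r. Qed.
Fact algZDr : right_distributive algZ +%R.
Proof. by move=> a x y; rewrite /algZ mulrDr. Qed.
Fact algZDl x : {morph algZ^~ x : a b / a + b}.
Proof. by move=> a b; rewrite /algZ rmorphD mulrDl. Qed.

HB.instance Definition _ :=
  GRing.Zmodule_isLmodule.Build R (alg_mod A) algZA alg1Z algZDr algZDl.

End AlgebraModule.

(* A right S-module is an lmodType over the converse ring S^c.                 *)

Definition lmod_iso (T : pzRingType) (V W : lmodType T) : Prop :=
  exists f : {linear V -> W}, bijective f.

Definition direct_summand (T : pzRingType) (V W : lmodType T) : Prop :=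
  exists U : lmodType T, lmod_iso (V * U)%type W.

Definition finitely_generated (T : pzRingType) (V : lmodType T) : Prop :=
  exists (n : nat) (v : 'I_n -> V),
    forall x, exists c : 'I_n -> T, x = \sum_i c i *: v i.

Definition module_finite (R : comPzRingType) (A : centralAlgType R) : Prop :=
  finitely_generated (alg_mod A).

(* An exact sequence T^m --f--> T^n --g--> V --> 0. *)
Definition finitely_presented (T : pzRingType) (V : lmodType T) : Prop :=
  exists (m n : nat) (f : {linear 'rV[T]_m -> 'rV[T]_n})
         (g : {linear 'rV[T]_n -> V}),
    (forall x, exists v, g v = x) /\
    (forall v, g v = 0 <-> exists w, f w = v).

Record dsum (T : pzRingType) (I : Type) (F : I -> lmodType T) := Dsum {
  dsum_fun :> forall i, F i;
  dsum_finite : finite_set [set i | dsum_fun i != 0]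
}.

Section DirectSum.
Variables (T : pzRingType) (I : Type) (F : I -> lmodType T).
Implicit Types x y z : dsum F.

Lemma dsumP x y : (forall i, x i = y i) -> x = y.
Proof.
case: x y => [f ff] [g fg] /= fg_eq.
have e : f = g by apply: functional_extensionality_dep.
by subst g; congr Dsum; exact: Prop_irrelevance.
Qed.

HB.instance Definition _ := gen_eqMixin (dsum F).
HB.instance Definition _ := gen_choiceMixin (dsum F).

Fact dsum0_finite : finite_set [set i | (0 : F i) != 0].
Proof.
by apply: (sub_finite_set _ (finite_set0 I)) => i /=; rewrite eqxx.
Qed.
Definition dsum0 : dsum F := Dsum dsum0_finite.

Fact dsumN_finite x : finite_set [set i | - x i != 0].
Proof.
by apply: sub_finite_set (dsum_finite x) => i /=; rewrite oppr_eq0.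
Qed.
Definition dsumN x : dsum F := Dsum (dsumN_finite x).

Fact dsumD_finite x y : finite_set [set i | x i + y i != 0].
Proof.
have : finite_set ([set i | x i != 0] `|` [set i | y i != 0]).
  by rewrite finite_setU; split; exact: dsum_finite.
apply: sub_finite_set => i /= xy0; have [x0|] := eqVneq (x i) 0; last by left.
by right; move: xy0; rewrite x0 add0r.
Qed.
Definition dsumD x y : dsum F := Dsum (dsumD_finite x y).

Fact dsumZ_finite a x : finite_set [set i | a *: x i != 0].
Proof.
apply: sub_finite_set (dsum_finite x) => i /=.
by apply: contra_neq => ->; rewrite scaler0.
Qed.
Definition dsumZ a x : dsum F := Dsum (dsumZ_finite a x).

Fact dsumDA : associative dsumD.
Proof. by move=> x y z; apply: dsumP => i /=; rewrite addrA. Qed.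
Fact dsumDC : commutative dsumD.
Proof. by move=> x y; apply: dsumP => i /=; rewrite addrC. Qed.
Fact dsum0D : left_id dsum0 dsumD.
Proof. by move=> x; apply: dsumP => i /=; rewrite add0r. Qed.
Fact dsumND : left_inverse dsum0 dsumN dsumD.
Proof. by move=> x; apply: dsumP => i /=; rewrite addNr. Qed.

HB.instance Definition _ :=
  GRing.isZmodule.Build (dsum F) dsumDA dsumDC dsum0D dsumND.

Fact dsumZA a b x : dsumZ a (dsumZ b x) = dsumZ (a * b) x.
Proof. by apply: dsumP => i /=; rewrite scalerA. Qed.
Fact dsum1Z : left_id 1 dsumZ.
Proof. by move=> x; apply: dsumP => i /=; rewrite scale1r. Qed.
Fact dsumZDr : right_distributive dsumZ +%R.
Proof. by move=> a x y; apply: dsumP => i /=; rewrite scalerDr. Qed.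
Fact dsumZDl x : {morph dsumZ^~ x : a b / a + b}.
Proof. by move=> a b; apply: dsumP => i /=; rewrite scalerDl. Qed.

HB.instance Definition _ :=
  GRing.Zmodule_isLmodule.Build T (dsum F) dsumZA dsum1Z dsumZDr dsumZDl.

End DirectSum.

(* A right S-module seen as an R-module through R -> S.                        *)

Definition restr (R : comPzRingType) (S : centralAlgType R) (N : lmodType S^c) :
  Type := N.

Section Restriction.
Variables (R : comPzRingType) (S : centralAlgType R) (N : lmodType S^c).

HB.instance Definition _ := GRing.Zmodule.on (restr N).

Definition restrZ (r : R) (x : restr N) : restr N :=
  (alg_map S r : S^c) *: (x : N).

Fact restrZA a b x : restrZ a (restrZ b x) = restrZ (a * b) x.
Proof. by rewrite /restrZ scalerA [in RHS]mulrC rmorphM. Qed.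
Fact restr1Z : left_id 1 restrZ.
Proof. by move=> x; rewrite /restrZ rmorph1 -[RHS](scale1r (x : N)). Qed.
Fact restrZDr : right_distributive restrZ +%R.
Proof. by move=> a x y; rewrite /restrZ scalerDr. Qed.
Fact restrZDl x : {morph restrZ^~ x : a b / a + b}.
Proof. by move=> a b; rewrite /restrZ rmorphD -[RHS]scalerDl. Qed.

HB.instance Definition _ := GRing.Zmodule_isLmodule.Build R (restr N)
  restrZA restr1Z restrZDr restrZDl.

(* r in R acts S-linearly, because its image in S is central. *)
Lemma restrZ_linear (r : R) (a : S^c) (x : N) :
  r *: (a *: x : restr N) = a *: (r *: (x : restr N) : N).
Proof.
transitivity (((alg_map S r : S^c) * a) *: x).
  exact: (scalerA (alg_map S r : S^c) a x).
rewrite (_ : (alg_map S r : S^c) * a = a * (alg_map S r : S^c)).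
  exact/esym/(scalerA a (alg_map S r : S^c) x).
exact/esym/alg_mapC.
Qed.

End Restriction.

(* The R-algebra End_S(N) acts on the left of N, with composition as product.  *)
Record endo (R : comPzRingType) (S : centralAlgType R) (N : lmodType S^c) := Endo {
  endo_fun :> N -> N;
  endo_linear : linear endo_fun
}.

Section Endomorphisms.
Variables (R : comPzRingType) (S : centralAlgType R) (N : lmodType S^c).
Implicit Types f g h : endo N.

Lemma endoP f g : (forall x, f x = g x) -> f = g.
Proof.
case: f g => [f lf] [g lg] /= fg_eq.
have e : f = g by apply: functional_extensionality_dep.
by subst g; congr Endo; exact: Prop_irrelevance.
Qed.

HB.instance Definition _ := gen_eqMixin (endo N).
HB.instance Definition _ := gen_choiceMixin (endo N).
HB.instance Definition _ f :=
  GRing.isLinear.Build S^c N N *:%R (endo_fun f) (endo_linear f).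

Definition endo0 : endo N := Endo (linearP (\0 : {linear N -> N})).
Definition endo1 : endo N := Endo (linearP (idfun : {linear N -> N})).
Definition endoD f g : endo N := Endo (linearP (f \+ g : {linear N -> N})).
Definition endoM f g : endo N := Endo (linearP (f \o g : {linear N -> N})).
Fact endoN_linear f : linear (fun x => - f x).
Proof. by move=> a x y; rewrite linearP opprD scalerN. Qed.
Definition endoN f : endo N := Endo (endoN_linear f).
Fact endoZ_linear (r : R) f : linear (fun x => r *: (f x : restr N) : N).
Proof. by move=> a x y; rewrite linearP scalerDr restrZ_linear. Qed.
Definition endoZ (r : R) f : endo N := Endo (endoZ_linear r f).

Fact endoDA : associative endoD.
Proof. by move=> f g h; apply: endoP => x /=; rewrite addrA. Qed.
Fact endoDC : commutative endoD.
Proof. by move=> f g; apply: endoP => x /=; rewrite addrC. Qed.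
Fact endo0D : left_id endo0 endoD.
Proof. by move=> f; apply: endoP => x /=; rewrite add0r. Qed.
Fact endoND : left_inverse endo0 endoN endoD.
Proof. by move=> f; apply: endoP => x /=; rewrite addNr. Qed.

HB.instance Definition _ :=
  GRing.isZmodule.Build (endo N) endoDA endoDC endo0D endoND.

Fact endoMA : associative endoM.
Proof. by move=> f g h; apply: endoP. Qed.
Fact endo1M : left_id endo1 endoM.
Proof. by move=> f; apply: endoP. Qed.
Fact endoM1 : right_id endo1 endoM.
Proof. by move=> f; apply: endoP. Qed.
Fact endoMDl : left_distributive endoM +%R.
Proof. by move=> f g h; apply: endoP. Qed.
Fact endoMDr : right_distributive endoM +%R.
Proof. by move=> f g h; apply: endoP => x /=; rewrite raddfD. Qed.

HB.instance Definition _ := GRing.Zmodule_isPzRing.Build (endo N)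
  endoMA endo1M endoM1 endoMDl endoMDr.

Definition endo_map (r : R) : endo N := endoZ r 1.

Fact endo_map_zmod : zmod_morphism endo_map.
Proof. by move=> a b; apply: endoP => x /=; rewrite scalerBl. Qed.
Fact endo_map_monoid : monoid_morphism endo_map.
Proof.
by split=> [|a b]; apply: endoP => x /=; rewrite ?scale1r ?scalerA.
Qed.

HB.instance Definition _ :=
  GRing.isZmodMorphism.Build R (endo N) endo_map endo_map_zmod.
HB.instance Definition _ :=
  GRing.isMonoidMorphism.Build R (endo N) endo_map endo_map_monoid.

Fact endo_mapC (r : R) f : endo_map r * f = f * endo_map r.
Proof.
by apply: endoP => x /=; rewrite -![_ *: (_ : restr N)]/(restrZ _ _) /restrZ linearZ.
Qed.

End Endomorphisms.

Definition End_alg (R : comPzRingType) (S : centralAlgType R)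
    (N : lmodType S^c) : centralAlgType R := CentralAlg (@endo_mapC R S N).

Definition ideal (R : comPzRingType) (J : set R) : Prop :=
  [/\ J 0, forall x y, J x -> J y -> J (x + y) & forall r x, J x -> J (r * x)].

Record Spec (R : comPzRingType) := PrimeIdeal {
  spec_set :> set R;
  spec_ideal : ideal spec_set;
  spec_proper : ~ spec_set 1;
  spec_prime : forall x y, spec_set (x * y) -> spec_set x \/ spec_set y
}.

Definition Max (R : comPzRingType) : set (Spec R) :=
  [set m | forall J : set R, ideal J -> ~ J 1 -> m `<=` J -> J = m].

Section Zariski.
Variable R : comPzRingType.

HB.instance Definition _ := gen_eqMixin (Spec R).
HB.instance Definition _ := gen_choiceMixin (Spec R).

Definition zariski_closed (A : set R) : set (Spec R) := [set p | A `<=` p].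

Definition zariski_open (U : set (Spec R)) : Prop :=
  exists A : set R, ~` U = zariski_closed A.

Fact zariski_openT : zariski_open setT.
Proof.
exists setT; apply/seteqP; split=> p; first by move=> /(_ I).
by move=> pT; case: (spec_proper (pT 1 I)).
Qed.

Fact zariski_openI : setI_closed zariski_open.
Proof.
move=> U V [A UA] [B VB]; exists [set x | exists a b, [/\ A a, B b & x = a * b]].
rewrite setCI UA VB; apply/seteqP; split=> p /=.
  have [_ _ pM] := spec_ideal p.
  case=> sub x [a [b [Aa Bb ->]]]; last exact/pM/sub.
  by rewrite mulrC; exact/pM/sub.
move=> sub; have [pA|/existsNP[a /not_implyP[Aa npa]]] := pselect (A `<=` p).
  by left.
right=> b Bb; have : spec_set p (a * b) by apply: sub; exists a, b.
by move=> /spec_prime[].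
Qed.

Fact zariski_open_bigU (I : Type) (f : I -> set (Spec R)) :
  (forall i, zariski_open (f i)) -> zariski_open (\bigcup_i f i).
Proof.
move=> /choice[A fA]; exists (\bigcup_i A i); rewrite setC_bigcup.
apply/seteqP; split=> p /=.
  move=> fp x [i _ Aix]; have : (~` f i) p by exact: fp.
  by rewrite fA; apply.
move=> sub i _; suff : (~` f i) p by [].
by rewrite fA => x Aix; apply: sub; exists i.
Qed.

HB.instance Definition _ := isOpenTopological.Build (Spec R)
  zariski_openT zariski_openI zariski_open_bigU.

End Zariski.

Definition noetherian_space (T : topologicalType) : Prop :=
  ~ exists F : nat -> set T,
      (forall n, closed (F n)) /\ (forall n, F n.+1 `<` F n).

Definition irreducible_set (T : topologicalType) (Z : set T) : Prop :=
  Z !=set0 /\ forall A B : set T,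
    closed A -> closed B -> Z `<=` A `|` B -> Z `<=` A \/ Z `<=` B.

(* A chain Z_0 < ... < Z_n has length n, not n + 1. *)
Definition has_chain (T : topologicalType) (n : nat) : Prop :=
  exists Z : 'I_n.+1 -> set T,
    (forall i, closed (Z i) /\ irreducible_set (Z i)) /\
    (forall i j : 'I_n.+1, (i < j)%N -> Z i `<` Z j).

Definition finite_dimensional (T : topologicalType) : Prop :=
  exists d : nat, ubound [set n | has_chain T n] d.

(* The supremum is taken in nat: it is the dimension when the space is finite  *)
(* dimensional and nonempty, and 0 (not -oo) for the empty space.              *)
Definition krull_dim (T : topologicalType) : nat :=
  supremum 0%N [set n | has_chain T n].

(* den p is R \ p, and loc p V is the R-module V localized at it. *)
Section Localization.
Variables (R : comPzRingType) (p : Spec R).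

Definition den : Type := set_type (~` (p : set R)).
HB.instance Definition _ := Choice.on den.

Definition den_val (s : den) : R := set_val s.

Lemma denP (s : den) : ~ spec_set p (den_val s).
Proof. by have := set_valP s. Qed.

Lemma den1_subproof : 1 \in ~` (p : set R).
Proof. by apply/mem_set; exact: spec_proper. Qed.
Definition den1 : den := SigSub den1_subproof.

Lemma denM_subproof (s t : den) : den_val s * den_val t \in ~` (p : set R).
Proof.
by apply/mem_set => /= /spec_prime[]; exact: denP.
Qed.
Definition denM (s t : den) : den := SigSub (denM_subproof s t).

Lemma den_valM s t : den_val (denM s t) = den_val s * den_val t.
Proof. by []. Qed.

Lemma den_val1 : den_val den1 = 1.
Proof. by []. Qed.

Variable V : lmodType R.

(* x / s = y / t iff u (t x - s y) = 0 for some u in R \ p. *)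
Definition loc_equiv (a b : V * den) : bool :=
  `[< exists u : den,
        den_val u *: (den_val b.2 *: a.1 - den_val a.2 *: b.1) = 0 >].

Fact loc_equiv_refl : reflexive loc_equiv.
Proof. by move=> a; apply/asboolP; exists den1; rewrite subrr scaler0. Qed.

Fact loc_equiv_sym : symmetric loc_equiv.
Proof.
by move=> a b; apply/asboolP/asboolP => -[u e]; exists u;
  rewrite -opprB scalerN e oppr0.
Qed.

Fact loc_equiv_trans : transitive loc_equiv.
Proof.
move=> b a c /asboolP[u e1] /asboolP[v e2]; apply/asboolP.
exists (denM (denM u v) b.2).
rewrite !den_valM; move: e1 e2.
case: a b c => [x s] [y t] [z w] /= e1 e2.
move: (den_val s) (den_val t) (den_val w) (den_val u) (den_val v) e1 e2
  => {}s {}t {}w {}u {}v.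
rewrite !scalerBr !scalerA => /eqP; rewrite subr_eq0 => /eqP e1.
move=> /eqP; rewrite subr_eq0 => /eqP e2; apply/eqP; rewrite subr_eq0; apply/eqP.
rewrite (_ : u * v * t * w = (v * w) * (u * t)); last by ring.
rewrite -(scalerA (v * w)) e1 scalerA (_ : v * w * (u * s) = (u * s) * (v * w)); last by ring.
by rewrite -(scalerA (u * s)) e2 scalerA; congr (_ *: _); ring.
Qed.

Definition loc_equiv_rel :=
  EquivRel loc_equiv loc_equiv_refl loc_equiv_sym loc_equiv_trans.

Definition loc : Type := {eq_quot loc_equiv_rel}.
HB.instance Definition _ := Choice.on loc.

Definition frac (x : V) (s : den) : loc := \pi_({eq_quot loc_equiv_rel}) (x, s).

Lemma frac_eq x s y t : frac x s = frac y t <->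
  exists u : den, den_val u *: (den_val t *: x - den_val s *: y) = 0.
Proof.
split=> [/eqmodP /asboolP //|e]; apply/eqmodP; exact/asboolP.
Qed.

Definition num_of (a : loc) : V := (repr (a : {eq_quot loc_equiv_rel})).1.
Definition den_of (a : loc) : den := (repr (a : {eq_quot loc_equiv_rel})).2.

Lemma fracK a : frac (num_of a) (den_of a) = a.
Proof. by rewrite /frac -surjective_pairing reprK. Qed.

End Localization.

Section LocZmodule.
Variables (R : comPzRingType) (p : Spec R) (V : lmodType R).
Implicit Types (x y z : V) (s t u : den p) (a b c : loc p V).

Definition loc0 : loc p V := frac 0 (den1 p).
Definition locN a : loc p V := frac (- num_of a) (den_of a).
Definition locD a b : loc p V :=
  frac (den_val (den_of b) *: num_of a + den_val (den_of a) *: num_of b)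
       (denM (den_of a) (den_of b)).

Lemma locP a : exists x s, a = frac x s.
Proof. by exists (num_of a), (den_of a); rewrite fracK. Qed.

Lemma frac_cross x s y t :
  den_val t *: x = den_val s *: y -> frac x s = frac y t.
Proof. by move=> e; apply/frac_eq; exists (den1 p); rewrite e subrr scaler0. Qed.

Lemma frac_eqr x s y t : frac x s = frac y t <-> exists u,
  (den_val u * den_val t) *: x = (den_val u * den_val s) *: y.
Proof.
split=> [/frac_eq|] [u e].
  by exists u; move/eqP: e; rewrite scalerBr !scalerA subr_eq0 => /eqP.
by apply/frac_eq; exists u; rewrite scalerBr !scalerA e subrr.
Qed.

Lemma fracE x s : exists u,
  (den_val u * den_val s) *: num_of (frac x s) =
  (den_val u * den_val (den_of (frac x s))) *: x.
Proof.
by have /frac_eqr[u e] := fracK (frac x s); exists u.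
Qed.

Lemma locN_frac x s : locN (frac x s) = frac (- x) s.
Proof.
have [u e] := fracE x s; apply/frac_eqr; exists u.
by rewrite !scalerN e.
Qed.

Lemma locD_frac x s y t :
  locD (frac x s) (frac y t) = frac (den_val t *: x + den_val s *: y) (denM s t).
Proof.
have [u e] := fracE x s; have [v f] := fracE y t.
rewrite /locD; move: (num_of _) (den_of _) e (num_of _) (den_of _) f.
move=> x' s' e y' t' f; apply/frac_eqr; exists (denM u v).
rewrite !den_valM !scalerDr !scalerA.
move: (den_val u) (den_val v) (den_val s) (den_val t) (den_val s') (den_val t') e f.
move=> {}u {}v {}s {}t {}s' {}t' e f.
congr (_ + _).
  rewrite [X in X *: x'](_ : _ = (v * t * t') * (u * s)); last by ring.
  by rewrite -(scalerA (v * t * t')) e scalerA; congr (_ *: _); ring.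
rewrite [X in X *: y'](_ : _ = (u * s * s') * (v * t)); last by ring.
by rewrite -(scalerA (u * s * s')) f scalerA; congr (_ *: _); ring.
Qed.

Fact locDA : associative locD.
Proof.
move=> a b c; have [x [s ->]] := locP a; have [y [t ->]] := locP b.
have [z [w ->]] := locP c; rewrite !locD_frac; apply: frac_cross.
rewrite !den_valM !scalerDr !scalerA -!addrA.
by congr (_ + (_ + _)); congr (_ *: _); ring.
Qed.
Fact locDC : commutative locD.
Proof.
move=> a b; have [x [s ->]] := locP a; have [y [t ->]] := locP b.
rewrite !locD_frac; apply: frac_cross.
by rewrite !den_valM addrC mulrC.
Qed.
Fact loc0D : left_id loc0 locD.
Proof.
move=> a; have [x [s ->]] := locP a; rewrite locD_frac scaler0 add0r.
by apply: frac_cross; rewrite den_valM den_val1 !mul1r scale1r.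
Qed.
Fact locND : left_inverse loc0 locN locD.
Proof.
move=> a; have [x [s ->]] := locP a; rewrite locN_frac locD_frac.
by apply: frac_cross; rewrite scalerN addNr !scaler0.
Qed.

HB.instance Definition _ :=
  GRing.isZmodule.Build (loc p V) locDA locDC loc0D locND.

Lemma addr_frac x s y t :
  frac x s + frac y t = frac (den_val t *: x + den_val s *: y) (denM s t).
Proof. exact: locD_frac. Qed.

End LocZmodule.

Definition Supp (R : comPzRingType) (V : lmodType R) : set (Spec R) :=
  [set p | exists x : loc p V, x != 0].

Section LocRing.
Variables (R : comPzRingType) (p : Spec R) (S : centralAlgType R).
Implicit Types (x y z : S) (s t u : den p).

Definition loc_ring : Type := loc p (alg_mod S).
HB.instance Definition _ := GRing.Zmodule.on loc_ring.
Implicit Types a b c : loc_ring.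

Definition rfrac x s : loc_ring := frac (x : alg_mod S) s.

Definition loc_one : loc_ring := rfrac 1 (den1 p).
Definition loc_mul a b : loc_ring :=
  rfrac ((num_of a : S) * (num_of b : S)) (denM (den_of a) (den_of b)).

Lemma algZMl (r : R) x y :
  (r *: (x : alg_mod S) : S) * y = r *: (x * y : alg_mod S).
Proof. exact/esym/mulrA. Qed.

Lemma algZMr (r : R) x y :
  x * (r *: (y : alg_mod S) : S) = r *: (x * y : alg_mod S).
Proof.
rewrite -[LHS]/(x * (alg_map S r * y)) mulrA -alg_mapC -mulrA; reflexivity.
Qed.

Lemma loc_mul_frac x s y t :
  loc_mul (rfrac x s) (rfrac y t) = rfrac (x * y) (denM s t).
Proof.
have [u e] := fracE (x : alg_mod S) s; have [v f] := fracE (y : alg_mod S) t.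
rewrite /loc_mul /rfrac; move: (num_of _) (den_of _) e (num_of _) (den_of _) f.
move=> x' s' e y' t' f; apply/frac_eqr; exists (denM u v).
rewrite !den_valM [LHS](_ : _ =
    (den_val u * den_val s) *: ((den_val v * den_val t) *: (x' * y' : alg_mod S))).
  2: by rewrite scalerA; congr (_ *: _); ring.
rewrite -algZMr f -algZMl e algZMl algZMr !scalerA.
by congr (_ *: _); ring.
Qed.

Lemma locRP a : exists x s, a = rfrac x s.
Proof. exact: (@locP _ p (alg_mod S) a). Qed.

Lemma addr_rfrac x s y t : rfrac x s + rfrac y t =
  rfrac (den_val t *: (x : alg_mod S) + den_val s *: (y : alg_mod S)) (denM s t).
Proof. exact: locD_frac. Qed.

Fact loc_mulA : associative loc_mul.
Proof.
move=> a b c; have [x [s ->]] := locRP a; have [y [t ->]] := locRP b.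
have [z [w ->]] := locRP c; rewrite !loc_mul_frac; apply: frac_cross.
by rewrite !den_valM !mulrA.
Qed.
Fact loc_mul1l : left_id loc_one loc_mul.
Proof.
move=> a; have [x [s ->]] := locRP a; rewrite loc_mul_frac; apply: frac_cross.
by rewrite !den_valM den_val1 !mul1r.
Qed.
Fact loc_mul1r : right_id loc_one loc_mul.
Proof.
move=> a; have [x [s ->]] := locRP a; rewrite loc_mul_frac; apply: frac_cross.
by rewrite !den_valM den_val1 !mulr1.
Qed.
Fact loc_mulDl : left_distributive loc_mul +%R.
Proof.
move=> a b c; have [x [s ->]] := locRP a; have [y [t ->]] := locRP b.
have [z [w ->]] := locRP c; rewrite addr_rfrac !loc_mul_frac addr_rfrac.
apply: frac_cross; rewrite !den_valM mulrDl !algZMl !scalerDr !scalerA.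
by congr (_ + _); congr (_ *: _); ring.
Qed.
Fact loc_mulDr : right_distributive loc_mul +%R.
Proof.
move=> a b c; have [x [s ->]] := locRP a; have [y [t ->]] := locRP b.
have [z [w ->]] := locRP c; rewrite addr_rfrac !loc_mul_frac addr_rfrac.
apply: frac_cross; rewrite !den_valM mulrDr !algZMr !scalerDr !scalerA.
by congr (_ + _); congr (_ *: _); ring.
Qed.

HB.instance Definition _ := GRing.Zmodule_isPzRing.Build loc_ring
  loc_mulA loc_mul1l loc_mul1r loc_mulDl loc_mulDr.

Lemma mulr_rfrac x s y t : rfrac x s * rfrac y t = rfrac (x * y) (denM s t).
Proof. exact: loc_mul_frac. Qed.

End LocRing.

(* The right action of S_p on N_p is (x / s) (y / t) = (x y) / (s t). *)
Section LocModule.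
Variables (R : comPzRingType) (p : Spec R) (S : centralAlgType R).
Variable N : lmodType S^c.
Implicit Types (x y : N) (s t u : den p).

Definition loc_mod : Type := loc p (restr N).
HB.instance Definition _ := GRing.Zmodule.on loc_mod.
Implicit Types n m : loc_mod.
Implicit Types a b : (loc_ring p S)^c.

Definition mfrac x s : loc_mod := frac (x : restr N) s.

Definition loc_scale a n : loc_mod :=
  mfrac ((num_of (a : loc_ring p S) : S^c) *: (num_of n : N))
        (denM (den_of (a : loc_ring p S)) (den_of n)).

Lemma locMP n : exists x s, n = mfrac x s.
Proof. exact: (@locP _ p (restr N) n). Qed.

Lemma restrZZl (r : R) (a : S) x :
  ((r *: (a : alg_mod S) : S) : S^c) *: x = r *: ((a : S^c) *: x : restr N).
Proof.
transitivity (((alg_map S r : S^c) * (a : S^c)) *: x).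
  by congr (_ *: x); exact: alg_mapC.
exact/esym/(scalerA (alg_map S r : S^c) (a : S^c) x).
Qed.

Lemma restrZZr (r r' : R) (a : S) x :
  r *: (r' *: ((a : S^c) *: x : restr N)) =
  ((r *: (a : alg_mod S) : S) : S^c) *: (r' *: (x : restr N) : N).
Proof. by rewrite [in LHS]restrZ_linear -[LHS]restrZZl. Qed.

Lemma loc_scale_frac (y : S) t x s :
  loc_scale (rfrac y t) (mfrac x s) = mfrac ((y : S^c) *: x) (denM t s).
Proof.
have [u e] := fracE (y : alg_mod S) t; have [v f] := fracE (x : restr N) s.
rewrite /loc_scale /mfrac /rfrac.
move: (num_of _) (den_of _) e (num_of _) (den_of _) f.
move=> y' t' e x' s' f; apply/frac_eqr; exists (denM u v).
rewrite !den_valM [LHS](_ : _ = (den_val u * den_val t) *: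
    ((den_val v * den_val s) *: ((y' : S^c) *: x' : restr N))).
  2: by rewrite scalerA; congr (_ *: _); ring.
rewrite restrZZr e f -restrZZr !scalerA.
by congr (_ *: _); ring.
Qed.

Lemma addr_mfrac x s y t : mfrac x s + mfrac y t =
  mfrac (den_val t *: (x : restr N) + den_val s *: (y : restr N)) (denM s t).
Proof. exact: locD_frac. Qed.

Fact loc_scaleA a b n : loc_scale a (loc_scale b n) = loc_scale (a * b) n.
Proof.
have [y [t ->]] := locRP a; have [z [w ->]] := locRP b.
have [x [s ->]] := locMP n.
rewrite -[X in _ = loc_scale X _]/(rfrac z w * rfrac y t : loc_ring p S).
rewrite mulr_rfrac !loc_scale_frac scalerA; apply: frac_cross.
by rewrite !den_valM [den_val w * den_val t]mulrC mulrA.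
Qed.
Fact loc_scale1 : left_id 1 loc_scale.
Proof.
move=> n; have [x [s ->]] := locMP n.
rewrite -[1]/(rfrac (1 : S) (den1 p)) loc_scale_frac; apply: frac_cross.
by rewrite den_valM den_val1 mul1r -[(1 : S)]/(1 : S^c) scale1r.
Qed.
Fact loc_scaleDr : right_distributive loc_scale +%R.
Proof.
move=> a n m; have [y [t ->]] := locRP a; have [x [s ->]] := locMP n.
have [z [w ->]] := locMP m; rewrite addr_mfrac !loc_scale_frac addr_mfrac.
apply: frac_cross; rewrite !den_valM scalerDr -!restrZ_linear !scalerDr !scalerA.
by congr (_ + _); congr (_ *: _); ring.
Qed.
Fact loc_scaleDl n : {morph loc_scale^~ n : a b / a + b}.
Proof.
move=> a b; have [y [t ->]] := locRP a; have [z [w ->]] := locRP b.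
have [x [s ->]] := locMP n.
rewrite -[X in loc_scale X _]/(rfrac y t + rfrac z w : loc_ring p S).
rewrite addr_rfrac !loc_scale_frac addr_mfrac.
apply: frac_cross; rewrite !den_valM.
have D (c d : S) : ((c + d : S) : S^c) *: x = (c : S^c) *: x + (d : S^c) *: x.
  exact: (@scalerDl S^c N x c d).
rewrite D !restrZZl !scalerDr !scalerA.
by congr (_ + _); congr (_ *: _); ring.
Qed.

HB.instance Definition _ := GRing.Zmodule_isLmodule.Build (loc_ring p S)^c
  loc_mod loc_scaleA loc_scale1 loc_scaleDr loc_scaleDl.

End LocModule.

(* Main.v *)
(* Let E = End_S(N) and d = dim Y. An isomorphism N + L = N + M restricts on N  *)
(* to a map (a, q) : N -> N + M with a left inverse. If some h : N -> M makes   *)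
(* q + h a split, elementary automorphisms of N + M carry (a, q) to (1, 0), so  *)
(* that L = M. Lifting the local splittings yields finitely many x_j : N -> M   *)
(* such that d + 1 of them are independently split at each maximal ideal m;     *)
(* composing with finitely many maps M -> N turns the search for h into a       *)
(* matrix problem over the module-finite algebra E. As in Eisenbud-Evans, the   *)
(* columns x_j are eliminated one at a time: discarding the column x, replace   *)
(* the column v of q by v + x c a and the other columns x_i by x_i + x c_i,     *)
(* where the c's are prescribed modulo one m on each component of the           *)
(* degeneracy loci; each step lets the dimensions of these loci drop by one.    *)
(* Ranks are replaced by the number of rows that must be adjoined to make a     *)
(* matrix left invertible at m, so that the computation at m only uses that     *)
(* E / mE, being artinian, has stable range one.                                *)
From HB Require Import structures.
Require Import Defs.
From mathcomp Require Import all_boot all_order all_algebra generic_quotient.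
From mathcomp Require Import all_classical topology.
From mathcomp Require Import ring.

Set Implicit Arguments.
Unset Strict Implicit.
Unset Printing Implicit Defensive.

Import GRing.Theory.

Local Open Scope classical_set_scope.
Local Open Scope ring_scope.
Local Open Scope quotient_scope.

(** * Stable range of artinian rings *)

(** Reduction. Adding a complement of K in N^n to both sides, and then removing the copies of N one
    at a time ([cancel_summand], [cancel_power]), leaves only the case K = N. Write the isomorphism
    on N as a column (a, q), with b a + r q = 1 read off from its inverse. By [unimodular_cancel] it
    is enough to find h : N -> M such that q + h a has a left inverse.

    Splitting data. Put D = 1 + dim Y. By finite presentation, the splitting of N_m^D off P_m
    descends to D maps x_j from N and D maps y_i back with y_i x_j = s or 0 according as i = j or
    not, where s is outside m ([local_split]). Finitely many of these s generate the unit ideal. Let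
    x_1, ..., x_n be all the maps so obtained, let g_i run over the maps y_i and r, and form X =
    (g_i x_j) and v = (g_i q) over E. It remains to find a column e over E such that v + X e a is
    left invertible ([cancel_endo_finite]).

    Dimension count. The k-th locus consists of the m in Y where (X | v), with its n + 1 columns,
    does not become left invertible near m after adjoining k rows. It is closed. It is empty if k >=
    n + 1 - D, because D of the columns are split at m; otherwise D <= n - k and its dimension is
    less than D. So it has dimension less than n - k for every k <= n, and [stable_columns] shows by
    induction on n that this suffices. To discard one column, [local_step] prescribes residues at
    one m that lower the deficiency there by one, [dim_lt_drop] reduces the requirement to finitely
    many m, and [ext_crt] meets these prescriptions together. For n = 0 the 0-th locus is empty, so
    v is left invertible locally, hence globally. Stable range one of E / mE ([stable_range_one])
    enters through [absorb_column], on which [local_step] rests. *)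

Section StableRange.
Variable A : pzRingType.
Implicit Types (a b x y z : A) (L M : set A).

Definition left_ideal L : Prop :=
  [/\ L 0, forall x y, L x -> L y -> L (x + y) & forall a x, L x -> L (a * x)].

Definition left_noetherian : Prop := forall L : nat -> set A,
  (forall n, left_ideal (L n)) -> (forall n, L n `<=` L n.+1) ->
  exists n, L n.+1 `<=` L n.

Definition left_artinian : Prop := forall L : nat -> set A,
  (forall n, left_ideal (L n)) -> (forall n, L n.+1 `<=` L n) ->
  exists n, L n `<=` L n.+1.

Lemma left_ideal0 L : left_ideal L -> L 0. Proof. by case. Qed.
Lemma left_idealD L x y : left_ideal L -> L x -> L y -> L (x + y).
Proof. by case=> _ + _; apply. Qed.
Lemma left_idealM L a x : left_ideal L -> L x -> L (a * x).
Proof. by case=> _ _; apply. Qed.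
Lemma left_idealN L x : left_ideal L -> L x -> L (- x).
Proof. by move=> iL Lx; rewrite -mulN1r; exact: left_idealM. Qed.
Lemma left_idealB L x y : left_ideal L -> L x -> L y -> L (x - y).
Proof. by move=> iL Lx Ly; apply: left_idealD => //; exact: left_idealN. Qed.

Lemma left_ideal_zero : left_ideal [set 0].
Proof. by split=> //= [x y -> ->|a x ->]; rewrite ?addr0 ?mulr0. Qed.

Definition multiples a L : set A := [set x | exists w j, L j /\ x = w * a + j].

Lemma left_ideal_multiples a L : left_ideal L -> left_ideal (multiples a L).
Proof.
move=> iL; split=> [|x y|z x].
- by exists 0, 0; rewrite mul0r addr0; split=> //; exact: left_ideal0.
- move=> [w [j [Lj ->]]] [w' [j' [Lj' ->]]]; exists (w + w'), (j + j').
  by rewrite mulrDl addrACA; split=> //; exact: left_idealD.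
- move=> [w [j [Lj ->]]]; exists (z * w), (z * j).
  by rewrite mulrDr mulrA; split=> //; exact: left_idealM.
Qed.

(** A surjective endomorphism of a noetherian module is injective, applied to right multiplication
    by a on M / L. The kernels [K n] of its powers become stationary, and an x killed by a is y a^n
    modulo L with y in [K n.+1], hence in [K n]. *)
Lemma surjective_injective L M a : left_noetherian -> left_ideal L ->
    left_ideal M -> L `<=` M -> (forall x, L x -> L (x * a)) ->
    (forall x, M x -> exists y, M y /\ L (x - y * a)) ->
  forall x, M x -> L (x * a) -> L x.
Proof.
move=> noeth iL iM LM La surj.
have LaX n x : L x -> L (x * a ^+ n).
  by elim: n => [|n IHn] Lx; rewrite ?mulr1 // exprSr mulrA; exact/La/IHn.
pose K n : set A := [set x | M x /\ L (x * a ^+ n)].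
have iK n : left_ideal (K n).
  split=> [|x y [Mx Lx] [My Ly]|b x [Mx Lx]]; split.
  - exact: left_ideal0.
  - by rewrite mul0r; exact: left_ideal0.
  - exact: left_idealD.
  - by rewrite mulrDl; exact: left_idealD.
  - exact: left_idealM.
  - by rewrite -mulrA; exact: left_idealM.
have [|n Kn] := noeth K iK.
  by move=> n x [Mx Lx]; split=> //; rewrite exprSr mulrA; exact: La.
have lift i x : M x -> exists y, M y /\ L (x - y * a ^+ i).
  elim: i x => [|i IHi] x Mx; first by exists x; rewrite mulr1 subrr;
    split=> //; exact: left_ideal0.
  have [y [My Ly]] := surj _ Mx; have [z [Mz Lz]] := IHi _ My.
  exists z; split=> //; rewrite exprSr mulrA.
  rewrite -(subrKA (y * a)) -mulrBl addrC; apply: left_idealD => //.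
  exact: La.
move=> x Mx Lxa; have [y [My Ly]] := lift n _ Mx.
have [_ Lyn] : K n y.
  apply: Kn; split=> //; rewrite exprSr mulrA.
  rewrite -[_ * a](subrK (x * a)) -mulrBl; apply: left_idealD => //.
  by apply: La; rewrite -opprB; exact: left_idealN.
by rewrite -(subrK (y * a ^+ n) x); exact: left_idealD.
Qed.

Lemma left_inverse_right a u : left_noetherian -> u * a = 1 -> a * u = 1.
Proof.
move=> noeth ua; apply/eqP; rewrite -subr_eq0; apply/eqP.
apply: (@surjective_injective [set 0] setT a) => //.
- exact: left_ideal_zero.
- by move=> x /= ->; rewrite mul0r.
- by move=> x _; exists (x * u); rewrite -mulrA ua mulr1 subrr.
- by rewrite /= mulrBl -mulrA ua mulr1 mul1r subrr.
Qed.

Lemma noetherian_maximal (T : Type) (F : T -> set A) (t0 : T) :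
    left_noetherian -> (forall t, left_ideal (F t)) ->
  exists t, forall t', F t `<=` F t' -> F t' `<=` F t.
Proof.
move=> noeth iF; apply: contrapT => /forallNP nmax.
have /choice[f Pf] t : exists t', F t `<=` F t' /\ ~ F t' `<=` F t.
  by have /existsNP[t' /not_implyP[]] := nmax t; exists t'.
have [n||n Fn] := noeth (fun n => F (iter n f t0)) => //= [n|].
  by case: (Pf (iter n f t0)).
by case: (Pf (iter n f t0)).
Qed.

Definition jacobson : set A := [set x | forall y, exists u, u * (1 + y * x) = 1].

Lemma left_ideal_jacobson : left_ideal jacobson.
Proof.
split=> [y|x x' Jx Jx' y|a x Jx y].
- by exists 1; rewrite mulr0 addr0 mul1r.
- have [u uP] := Jx y; have [w wP] := Jx' (u * y); exists (w * u).
  by rewrite (mulrDr y) addrA -mulrA (mulrDr u) uP mulrA.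
- by rewrite mulrA; exact: Jx.
Qed.

Lemma jacobson_mulr x z : jacobson x -> jacobson (x * z).
Proof.
move=> Jx y; have [u uP] := Jx (z * y); exists (1 - y * x * u * z).
have -> : (1 - y * x * u * z) * (1 + y * (x * z)) =
    1 + y * x * z - y * x * (u * (1 + z * y * x)) * z.
  by rewrite mulrBl mul1r !(mulrDr, mulrDl, mulr1, mulrA, mul1r).
by rewrite uP mulr1 addrK.
Qed.

Lemma jacobson_idempotent e : jacobson e -> e * e = e -> e = 0.
Proof.
move=> Je ee; have [u uP] := Je (- 1).
by rewrite -[LHS]mul1r -uP -mulrA mulN1r mulrBl mul1r ee subrr mulr0.
Qed.

(* Fitting's lemma for right multiplication by a non-nilpotent element. *)
Lemma idempotent_in_left_ideal L : left_noetherian -> left_artinian ->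
  left_ideal L -> ~ L `<=` jacobson ->
  exists e, [/\ L e, e * e = e & ~ jacobson e].
Proof.
move=> noeth art iL /existsNP[x /not_implyP[Lx /existsNP[y /forallNP nu]]].
pose z := - (y * x).
have Lz : L z by apply: left_idealN => //; exact: left_idealM.
(* If z were nilpotent, a geometric series would invert 1 - z = 1 + y x, against the choice of y. *)
have nz n : z ^+ n != 0.
  apply/eqP => zn; suff [g gP] : exists g, g * (1 - z) = 1 - z ^+ n.
    by apply: (nu g); rewrite -[y * x]opprK gP zn subr0.
  elim: n {zn} => [|n [g gP]]; first by exists 0; rewrite mul0r subrr.
  exists (g + z ^+ n); rewrite mulrDl gP mulrBr mulr1 -exprSr.
  by rewrite addrA subrK.
have [n||n zn] := art (fun n => multiples (z ^+ n) [set 0]).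
- exact/left_ideal_multiples/left_ideal_zero.
- move=> n t [w [j [/= -> ->]]]; exists (w * z), 0; split=> //.
  by rewrite -mulrA exprS.
have [w [j [/= -> ]]] : multiples (z ^+ n.+1) [set 0] (z ^+ n).
  by apply: zn; exists 1, 0; rewrite mul1r addr0.
rewrite addr0 => wz.
have wzi i : z ^+ n.+1 = w ^+ i * z ^+ (i + n.+1).
  elim: i => [|i IHi]; first by rewrite mul1r.
  rewrite {1}IHi exprSr -mulrA; congr (_ * _).
  by rewrite -addSnnS addnC exprD {1}wz -mulrA -exprD [(i.+1 + _)%N]addnC.
pose f := z ^+ n.+1; pose w' := w ^+ n.+1.
have fP : f = w' * (f * f) by rewrite /f -exprD; exact: wzi.
(* Since f = w' f f, right multiplication by f maps A f onto itself, hence injectively. This gives f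
   w' f = f, so that w' f is idempotent. *)
have inj t : t * f * f = 0 -> t * f = 0.
  move=> tff; apply: (@surjective_injective [set 0] (multiples f [set 0]) f) => //.
  - exact: left_ideal_zero.
  - exact/left_ideal_multiples/left_ideal_zero.
  - by move=> _ /= ->; exists 0, 0; rewrite mul0r addr0.
  - by move=> _ /= ->; rewrite mul0r.
  - move=> _ [s [_ [/= -> ->]]]; exists (s * w' * f); split.
      by exists (s * w'), 0; rewrite addr0.
    by rewrite addr0 {1}fP !mulrA subrr.
  - by exists t, 0; rewrite addr0.
have fwf : f * w' * f = f.
  apply/eqP; rewrite -subr_eq0 -[X in _ - X]mul1r -mulrBl; apply/eqP.
  by apply: inj; rewrite !mulrBl mul1r -!mulrA -fP subrr.
exists (w' * f); split.
- by apply: left_idealM => //; rewrite /f exprSr; exact: left_idealM.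
- by rewrite -mulrA [f * _]mulrA fwf.
- move=> Je; have /eqP := nz n.+1; apply; rewrite -/f -fwf -mulrA.
  by rewrite (jacobson_idempotent Je) ?mulr0 // -mulrA [f * _]mulrA fwf.
Qed.

(** Otherwise the descending chain A a^n + J yields (1 - w a) a^n in J, and injectivity strips off
    the factors a until 1 - w a is in J. *)
Lemma not_injective_mod_jacobson a : left_artinian ->
  ~ multiples a jacobson 1 -> ~ [set x | jacobson (x * a)] `<=` jacobson.
Proof.
move=> art na inj; apply: na; have iJ := left_ideal_jacobson.
have [n||n an] := art (fun n => multiples (a ^+ n) jacobson).
- exact: left_ideal_multiples.
- move=> n _ [w [j [Jj ->]]]; exists (w * a), j; split=> //.
  by rewrite -mulrA exprS.
have [w [j [Jj wj]]] : multiples (a ^+ n.+1) jacobson (a ^+ n).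
  by apply: an; exists 1, 0; rewrite mul1r addr0; split=> //; exact: left_ideal0.
have : jacobson ((1 - w * a) * a ^+ n).
  by rewrite mulrBl mul1r {1}wj -mulrA -exprS addrC addKr.
elim: n {an wj} => [|n IHn]; last by rewrite exprSr mulrA => /inj.
rewrite mulr1 => J1; exists w, (1 - w * a); split=> //.
by rewrite addrC subrK.
Qed.

(* Choose c so that A (a + c b) + J is maximal. If a + c b is not a unit, some *)
(* idempotent e outside J is killed by a + c b modulo J, and perturbing c by   *)
(* multiples of e shows e A to lie in A (a + c b) + J. Then right              *)
(* multiplication by a + c b is onto, hence injective, on A e A modulo J.      *)
Lemma stable_range_one a b x y : left_noetherian -> left_artinian ->
  x * a + y * b = 1 -> exists c u, u * (a + c * b) = 1 /\ (a + c * b) * u = 1.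
Proof.
move=> noeth art xy; have iJ := left_ideal_jacobson.
have [c cmax] : exists c, forall c',
    multiples (a + c * b) jacobson `<=` multiples (a + c' * b) jacobson ->
    multiples (a + c' * b) jacobson `<=` multiples (a + c * b) jacobson.
  apply: (@noetherian_maximal _ (fun c => multiples (a + c * b) jacobson) 0) => //.
  by move=> c; exact: left_ideal_multiples.
exists c; have [a' a'E] : exists a', a' = a + c * b by exists (a + c * b).
rewrite -a'E in cmax *.
have xa' : x * a' + (y - x * c) * b = 1.
  by rewrite a'E mulrDr mulrBl mulrA addrA addrAC -xy addrK.
suff [w [j [Jj wj]]] : multiples a' jacobson 1.
  have [u uP] := Jj (- 1 : A); exists (u * w).
  suff uwa : u * w * a' = 1 by split=> //; exact: left_inverse_right noeth uwa.
  by rewrite -mulrA -uP mulN1r wj addrK.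
apply: contrapT => na'.
have iK : left_ideal [set x | jacobson (x * a')].
  split=> [|s t /= Js Jt|s t /= Jt].
  - by rewrite /= mul0r; exact: left_ideal0.
  - by rewrite mulrDl; exact: (left_idealD iJ).
  - by rewrite -mulrA; exact: (left_idealM _ iJ).
have [e [/= Jea ee nJe]] := idempotent_in_left_ideal noeth art iK
  (not_injective_mod_jacobson art na').
have iL : left_ideal (multiples a' jacobson) by exact: left_ideal_multiples.
have sub_J t : jacobson t -> multiples a' jacobson t.
  by move=> Jt; exists 0, t; rewrite mul0r add0r.
have eb t : multiples a' jacobson (e * t * b).
  have aE : a + (c + e * t) * b = a' + e * t * b by rewrite mulrDl addrA a'E.
  rewrite -[_ * b](addKr (e * a')) addrC; apply: left_idealB => //; last exact: sub_J.
  apply: (cmax (c + e * t)).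
    move=> _ [w [j [Jj ->]]]; rewrite aE; exists (w * (1 - e)), (w * (e * a') + j).
    split; first by apply: (left_idealD iJ) => //; exact: (left_idealM _ iJ).
    rewrite addrA; congr (_ + _); rewrite -mulrA -mulrDr; congr (_ * _).
    by rewrite mulrDr !mulrBl !mul1r !mulrA ee subrr addr0 subrK.
  rewrite aE; exists e, 0; split; first exact: left_ideal0.
  by rewrite addr0 mulrDr !mulrA ee.
have eA t : multiples a' jacobson (e * t).
  have -> : e * t = e * t * x * a' + e * (t * (y - x * c)) * b.
    by rewrite -[LHS]mulr1 -xa' mulrDr !mulrA.
  by apply: left_idealD => //; exists (e * t * x), 0; rewrite addr0;
    split=> //; exact: left_ideal0.
(* [H] is the two-sided ideal A e A, encoded as the least additive set containing all s e t, so that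
   induction over its elements is immediate. *)
pose H : set A := [set h | forall M, (M 0 /\ (forall s t, M s -> M t -> M (s + t))) ->
  (forall s t, M (s * e * t)) -> M h].
have iH : left_ideal H.
  split=> [M [M0 _] _ //|s t Hs Ht M MD MG|s t Ht M [M0 MD] MG].
    by case: (MD) => _; apply; [exact: Hs|exact: Ht].
  apply: (Ht [set t | M (s * t)]); first split.
  - by rewrite /= mulr0.
  - by move=> p q /= Mp Mq; rewrite mulrDr; exact: MD.
  - by move=> p q /=; rewrite !mulrA; exact: MG.
pose HJ : set A := [set h | exists j, jacobson j /\ H (h - j)].
apply: nJe; apply: (@surjective_injective jacobson HJ a' noeth iJ) => //.
- split=> [|s t [j [Jj Hj]] [j' [Jj' Hj']]|s t [j [Jj Hj]]].
  + by exists 0; rewrite subrr; split; exact: left_ideal0.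
  + exists (j + j'); split; first exact: (left_idealD iJ).
    by rewrite opprD addrACA; exact: (left_idealD iH).
  + exists (s * j); split; first exact: (left_idealM _ iJ).
    by rewrite -mulrBr; exact: (left_idealM _ iH).
- by move=> j Jj; exists j; rewrite subrr; split=> //; exact: left_ideal0.
- by move=> j Jj; exact: jacobson_mulr.
- move=> h [j [Jj Hj]]; suff [s [Hs Js]] : exists s, H s /\ jacobson (h - j - s * a').
    exists s; split; first by exists 0; rewrite subr0; split=> //; exact: left_ideal0.
    by rewrite -(subrK j h) addrAC; exact: (left_idealD iJ).
  apply: (Hj [set t | exists s, H s /\ jacobson (t - s * a')]); first split.
  + by exists 0; rewrite mul0r subr0; split; exact: left_ideal0.
  + move=> s t [s' [Hs' Js']] [t' [Ht' Jt']]; exists (s' + t').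
    split; first exact: (left_idealD iH).
    by rewrite mulrDl opprD addrACA; exact: (left_idealD iJ).
  + move=> s t; have [w [k [Jk wk]]] := eA t; exists (s * e * w); split.
      by move=> M _; apply.
    rewrite -[s * e * t](_ : s * e * (e * t) = _); last by rewrite !mulrA -(mulrA s) ee.
    by rewrite wk mulrDr mulrA addrC addKr; exact: (left_idealM _ iJ).
- exists 0; split; first exact: left_ideal0.
  by rewrite subr0 => M _ /(_ 1 1); rewrite mul1r mulr1.
Qed.

End StableRange.

(** * Algebras over a residue field *)

Record two_sided_ideal (A : pzRingType) := TwoSidedIdeal {
  ideal_set :> A -> Prop;
  ideal_left : left_ideal (ideal_set : set A);
  ideal_right : forall x a, ideal_set x -> ideal_set (x * a)
}.

Section QuotientRing.
Variables (A : pzRingType) (I : two_sided_ideal A).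

Definition congruent (x y : A) : bool := `[< I (x - y) >].

Fact congruent_refl : reflexive congruent.
Proof.
by move=> x; apply/asboolP; rewrite subrr; exact: left_ideal0 (ideal_left I).
Qed.
Fact congruent_sym : symmetric congruent.
Proof.
by move=> x y; apply/asboolP/asboolP => Ixy; rewrite -opprB;
   exact: left_idealN (ideal_left I) _.
Qed.
Fact congruent_trans : transitive congruent.
Proof.
move=> y x z /asboolP Ixy /asboolP Iyz; apply/asboolP.
by rewrite -(subrKA y); exact: left_idealD (ideal_left I) _ _.
Qed.

Definition congruent_rel :=
  EquivRel congruent congruent_refl congruent_sym congruent_trans.

Definition quo : Type := {eq_quot congruent_rel}.
HB.instance Definition _ := Choice.on quo.

Definition to_quo (x : A) : quo := \pi_({eq_quot congruent_rel}) x.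

Lemma to_quo_eq x y : to_quo x = to_quo y <-> I (x - y).
Proof. by split=> [/eqmodP /asboolP //|Ixy]; apply/eqmodP/asboolP. Qed.

Lemma to_quo_surj (q : quo) : exists x, q = to_quo x.
Proof. by exists (repr (q : {eq_quot congruent_rel})); rewrite /to_quo reprK. Qed.

Definition quo_rep (q : quo) : A := repr (q : {eq_quot congruent_rel}).

Lemma quo_repP x : I (quo_rep (to_quo x) - x).
Proof. by apply/to_quo_eq; rewrite /to_quo reprK. Qed.

Definition quoN p := to_quo (- quo_rep p).
Definition quoD p q := to_quo (quo_rep p + quo_rep q).
Definition quoM p q := to_quo (quo_rep p * quo_rep q).

Lemma quoN_to x : quoN (to_quo x) = to_quo (- x).
Proof.
apply/to_quo_eq; rewrite -opprD.
exact: left_idealN (ideal_left I) (quo_repP x).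
Qed.
Lemma quoD_to x y : quoD (to_quo x) (to_quo y) = to_quo (x + y).
Proof.
apply/to_quo_eq; rewrite opprD addrACA.
exact: left_idealD (ideal_left I) (quo_repP x) (quo_repP y).
Qed.
Lemma quoM_to x y : quoM (to_quo x) (to_quo y) = to_quo (x * y).
Proof.
apply/to_quo_eq; set x' := quo_rep _; set y' := quo_rep _.
rewrite -(subrKA (x' * y)) -mulrBr -mulrBl.
apply: (left_idealD (ideal_left I)).
  exact: (left_idealM _ (ideal_left I) (quo_repP y)).
exact: ideal_right (quo_repP x).
Qed.

Fact quoDA : associative quoD.
Proof.
move=> a b c; have [x ->] := to_quo_surj a; have [y ->] := to_quo_surj b.
by have [z ->] := to_quo_surj c; rewrite !quoD_to addrA.
Qed.
Fact quoDC : commutative quoD.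
Proof. by move=> a b; rewrite /quoD addrC. Qed.
Fact quo0D : left_id (to_quo 0) quoD.
Proof. by move=> a; have [x ->] := to_quo_surj a; rewrite quoD_to add0r. Qed.
Fact quoND : left_inverse (to_quo 0) quoN quoD.
Proof.
by move=> a; have [x ->] := to_quo_surj a; rewrite quoN_to quoD_to addNr.
Qed.

HB.instance Definition _ := GRing.isZmodule.Build quo quoDA quoDC quo0D quoND.

Fact quoMA : associative quoM.
Proof.
move=> a b c; have [x ->] := to_quo_surj a; have [y ->] := to_quo_surj b.
by have [z ->] := to_quo_surj c; rewrite !quoM_to mulrA.
Qed.
Fact quo1M : left_id (to_quo 1) quoM.
Proof. by move=> a; have [x ->] := to_quo_surj a; rewrite quoM_to mul1r. Qed.
Fact quoM1 : right_id (to_quo 1) quoM.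
Proof. by move=> a; have [x ->] := to_quo_surj a; rewrite quoM_to mulr1. Qed.
Fact quoMDl : left_distributive quoM +%R.
Proof.
move=> a b c; have [x ->] := to_quo_surj a; have [y ->] := to_quo_surj b.
have [z ->] := to_quo_surj c; rewrite [X in quoM X _](quoD_to x y) !quoM_to.
by rewrite mulrDl -quoD_to.
Qed.
Fact quoMDr : right_distributive quoM +%R.
Proof.
move=> a b c; have [x ->] := to_quo_surj a; have [y ->] := to_quo_surj b.
have [z ->] := to_quo_surj c; rewrite [X in quoM _ X](quoD_to y z) !quoM_to.
by rewrite mulrDr -quoD_to.
Qed.

HB.instance Definition _ := GRing.Zmodule_isPzRing.Build quo
  quoMA quo1M quoM1 quoMDl quoMDr.

Fact to_quo_zmod : zmod_morphism to_quo.
Proof. by move=> x y; rewrite -quoD_to -quoN_to. Qed.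
Fact to_quo_monoid : monoid_morphism to_quo.
Proof. by split=> // x y; rewrite -quoM_to. Qed.

HB.instance Definition _ :=
  GRing.isZmodMorphism.Build A quo to_quo to_quo_zmod.
HB.instance Definition _ :=
  GRing.isMonoidMorphism.Build A quo to_quo to_quo_monoid.

Lemma to_quo_eq0 x : to_quo x = 0 <-> I x.
Proof. by rewrite -[X in I X]subr0; exact: to_quo_eq. Qed.

End QuotientRing.

(** * Submodules and chain conditions over a residue field *)

Section Submodules.
Variables (R : comPzRingType) (V : lmodType R).
Implicit Types (U : set V) (l : seq V) (r : R).

Definition submod U : Prop :=
  [/\ U 0, forall x y, U x -> U y -> U (x + y) & forall r x, U x -> U (r *: x)].

Lemma submod0 U : submod U -> U 0. Proof. by case. Qed.
Lemma submodD U x y : submod U -> U x -> U y -> U (x + y).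
Proof. by case=> _ + _; apply. Qed.
Lemma submodZ U r x : submod U -> U x -> U (r *: x).
Proof. by case=> _ _; apply. Qed.
Lemma submodB U x y : submod U -> U x -> U y -> U (x - y).
Proof.
by move=> sU Ux Uy; rewrite -scaleN1r; apply: submodD => //; exact: submodZ.
Qed.
Lemma submod_sum U (I : Type) (s : seq I) (F : I -> V) :
  submod U -> (forall i, U (F i)) -> U (\sum_(i <- s) F i).
Proof.
by move=> sU UF; apply: big_ind => [|x y|i _]; [exact: submod0|exact: submodD|].
Qed.

Fixpoint lin_span l : set V :=
  if l is w :: l' then [set x | exists r y, lin_span l' y /\ x = r *: w + y]
  else [set 0].

Lemma submod_span l : submod (lin_span l).
Proof.
elim: l => [|w l IHl] /=.
  by split=> [//|x y /= -> ->|r x /= ->]; rewrite ?addr0 ?scaler0.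
split=> [|x y [r [x' [lx ->]]] [s [y' [ly ->]]]|s x [r [x' [lx ->]]]].
- by exists 0, 0; rewrite scale0r addr0; split=> //; exact: submod0.
- exists (r + s), (x' + y'); rewrite scalerDl addrACA; split=> //.
  exact: submodD.
- exists (s * r), (s *: x'); rewrite scalerDr scalerA; split=> //.
  exact: submodZ.
Qed.

Lemma mem_span l x : x \in l -> lin_span l x.
Proof.
elim: l => //= w l IHl; rewrite inE => /orP[/eqP ->|/IHl lx].
  by exists 1, 0; rewrite scale1r addr0; split=> //; exact: submod0 (submod_span l).
by exists 0, x; rewrite scale0r add0r.
Qed.

Lemma finitely_generated_span :
  finitely_generated V -> exists l, forall x, lin_span l x.
Proof.
move=> [n [v vP]]; exists [seq v i | i <- enum 'I_n] => x.
have [c ->] := vP x; have sl := submod_span [seq v i | i <- enum 'I_n].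
apply: submod_sum => // i; apply: submodZ => //; apply: mem_span.
by apply: map_f; rewrite mem_enum.
Qed.

End Submodules.

Lemma max_inv (R : comPzRingType) (m : Spec R) r : Max m -> ~ spec_set m r ->
  exists s, spec_set m (s * r - 1).
Proof.
have [m0 mD mM] := spec_ideal m.
move=> maxm nmr; apply: contrapT => /forallNP ns.
pose J : set R := [set x | exists a s, spec_set m a /\ x = a + s * r].
suff JE : J = m by apply: nmr; rewrite -JE; exists 0, 1; rewrite add0r mul1r.
apply: maxm.
- split=> [|x y [a [s [ma ->]]] [b [t [mb ->]]]|b x [a [s [ma ->]]]].
  + by exists 0, 0; rewrite mul0r addr0.
  + by exists (a + b), (s + t); rewrite mulrDl addrACA; split=> //; exact: mD.
  + by exists (b * a), (b * s); rewrite mulrDr mulrA; split=> //; exact: mM.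
- move=> [a [s [ma one]]]; apply: (ns s).
  by rewrite one opprD addrCA subrr addr0 -mulN1r; exact: mM.
- by move=> x mx; exists x, 0; rewrite mul0r addr0.
Qed.

(* The first member of the chain that is not in the span of the tail of the    *)
(* list may be dropped: from there on, intersecting with that span keeps the   *)
(* inclusions strict.                                                          *)
Lemma chain_size (R : comPzRingType) (V : lmodType R) (m : Spec R) (l : seq V)
    (k : nat) (U : nat -> set V) : Max m ->
  (forall r (x : V), spec_set m r -> r *: x = 0) -> (forall i, submod (U i)) ->
  (forall i, (i < k)%N -> U i `<=` U i.+1) ->
  (forall i, (i < k)%N -> ~ U i.+1 `<=` U i) ->
  (forall i, (i <= k)%N -> U i `<=` lin_span l) -> (k <= size l)%N.
Proof.
move=> maxm mV; elim: l k U => [|w l IHl] k U sU inc strict sub.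
  case: k inc strict sub => // k inc strict sub; case: (strict 0%N) => //.
  by move=> x /(sub 1%N isT) /= ->; exact: submod0.
have sl := submod_span l.
have [all_sub|] := pselect (forall i, (i <= k)%N -> U i `<=` lin_span l).
  by apply: (leq_trans (IHl k U _ _ _ _)) => //=.
move=> /existsNP[i1 /not_implyP[i1k Ui1]].
have ex : exists i, `[< (i <= k)%N /\ ~ U i `<=` lin_span l >].
  by exists i1; apply/asboolP.
case: (ex_minnP ex) => i0 /asboolP[i0k /existsNP[z0 /not_implyP[Uz0 nz0]]] i0min.
have subl i : (i < i0)%N -> U i `<=` lin_span l.
  move=> ii0; apply: contrapT => nsub.
  suff : (i0 <= i)%N by rewrite leqNgt ii0.
  by apply: i0min; apply/asboolP; split=> //; exact: ltnW (leq_trans ii0 i0k).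
have mono i j : (i <= j <= k)%N -> U i `<=` U j.
  elim: j => [|j IHj] /andP[]; first by rewrite leqn0 => /eqP -> _ x.
  rewrite leq_eqVlt => /orP[/eqP -> _ x //|ij jk].
  by apply: subset_trans (inc _ jk); apply: IHj; rewrite -ltnS ij ltnW.
have key i : (i0 <= i < k)%N -> ~ U i.+1 `&` lin_span l `<=` U i.
  move=> /andP[i0i ik] Usub; apply: (strict _ ik) => z Uz.
  have [r [y [ly zE]]] := sub _ ik z Uz.
  have [r0 [y0 [ly0 z0E]]] := sub _ i0k z0 Uz0.
  have nmr0 : ~ spec_set m r0 by move=> /mV r0w; apply: nz0; rewrite z0E r0w add0r.
  have [s ms] := max_inv maxm nmr0.
  have swE : (s * r0) *: w = w.
    by apply/eqP; rewrite -subr_eq0 -[X in _ - X]scale1r -scalerBl mV.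
  have Uiz0 : U i z0 by apply: mono Uz0; rewrite i0i ltnW.
  rewrite -(subrK ((r * s) *: z0) z); apply: submodD => //; last exact: submodZ.
  apply: Usub; split; first by apply: submodB => //; apply: submodZ => //; exact: inc.
  have -> : z - (r * s) *: z0 = y - (r * s) *: y0.
    rewrite zE z0E scalerDr scalerA -mulrA -scalerA swE.
    by rewrite opprD addrACA subrr add0r.
  by apply: submodB => //; exact: submodZ.
suff : (k.-1 <= size l)%N by case: (k).
pose W j := if (j < i0)%N then U j else U j.+1 `&` lin_span l.
apply: (IHl k.-1 W) => [j|j jk|j jk|j jk].
- rewrite /W; case: ifP => // _; split=> [|x y [Ux lx] [Uy ly]|r x [Ux lx]].
  + by split; exact: submod0.
  + by split; exact: submodD.
  + by split; exact: submodZ.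
- have {}jk : (j.+1 < k)%N by case: (k) jk.
  rewrite /W; have [ji0|i0j] := ltnP j i0.
    case: ifP => _; first exact/inc/ltnW.
    move=> x Ux; split; last exact: subl Ux.
    by apply: mono Ux; rewrite jk andbT leqW.
  rewrite ifF; last by rewrite ltnNge leqW.
  by move=> x [Ux lx]; split=> //; exact: inc.
- have {}jk : (j.+1 < k)%N by case: (k) jk.
  rewrite /W; have [ji0|i0j] := ltnP j i0.
    case: ifP => [_|/negbT]; first exact/strict/ltnW.
    rewrite -leqNgt => i0j Usub; apply: (key j.+1); first by rewrite i0j.
    by apply: subset_trans Usub _; exact/inc/ltnW.
  rewrite ifF; last by rewrite ltnNge leqW.
  move=> Usub; apply: (key j.+1); first by rewrite leqW.
  by apply: subset_trans Usub _ => x [].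
- rewrite /W; case: ifP => [/subl //|_]; by move=> x [].
Qed.

Section ArtinianAlgebra.
Variables (R : comPzRingType) (A : centralAlgType R) (m : Spec R).
Hypotheses (maxm : Max m) (finA : module_finite A).
Hypothesis mA : forall r, spec_set m r -> alg_map A r = 0.

Let submod_left_ideal (L : set A) : left_ideal L -> submod (L : set (alg_mod A)).
Proof. by case=> L0 LD LM; split=> // r x; exact: LM. Qed.

Let mA0 r (x : alg_mod A) : spec_set m r -> r *: x = 0.
Proof. by move=> mr; rewrite -[LHS]/(alg_map A r * (x : A)) mA // mul0r. Qed.

Lemma alg_noetherian : left_noetherian A.
Proof.
move=> L iL inc; apply: contrapT => /forallNP strict.
have [l lP] := finitely_generated_span finA.
suff : ((size l).+1 <= size l)%N by rewrite ltnn.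
apply: (@chain_size _ (alg_mod A) m _ _ L) => //.
  by move=> i; exact: submod_left_ideal.
by move=> i _ x _.
Qed.

Lemma alg_artinian : left_artinian A.
Proof.
move=> L iL inc; apply: contrapT => /forallNP strict.
have [l lP] := finitely_generated_span finA.
suff : ((size l).+1 <= size l)%N by rewrite ltnn.
apply: (@chain_size _ (alg_mod A) m _ _ (fun i => L ((size l).+1 - i)%N)) => //.
- by move=> i; exact: submod_left_ideal.
- by move=> i ?; rewrite subSS subSn //; exact: inc.
- by move=> i ?; rewrite subSS subSn //; exact: strict.
- by move=> i _ x _.
Qed.

End ArtinianAlgebra.

(** * Nakayama's lemma *)

Section Nakayama.
Variables (R : comPzRingType) (V : lmodType R) (m : Spec R) (U : set V).
Hypothesis sU : submod U.

(** Elimination instead of a determinant. The last relation has diagonal coefficient [tau] outside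
    m, so it expresses [tau] times the last generator through the others. Substituting it keeps the
    shape of the system, with t replaced by [tau * t]; allowing a general t is what makes the
    induction close. *)
Lemma nakayama n (w : 'I_n -> V) (t : R) (mu : 'I_n -> 'I_n -> R) :
  ~ spec_set m t -> (forall i j, spec_set m (mu i j)) ->
  (forall i, U (t *: w i - \sum_j mu i j *: w j)) ->
  exists s, ~ spec_set m s /\ forall i, U (s *: w i).
Proof.
have [m0 mD mM] := spec_ideal m.
elim: n w t mu => [|n IHn] w t mu nt mmu Uw.
  by exists 1; split; [exact: spec_proper|case].
pose z := w ord_max; pose wd i := widen_ord (leqnSn n) i.
pose tau := t - mu ord_max ord_max.
have ntau : ~ spec_set m tau.
  move=> mt; apply: nt; rewrite -(subrK (mu ord_max ord_max) t); exact: mD.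
have Uz : U (tau *: z - \sum_(j < n) mu ord_max (wd j) *: w (wd j)).
  by have := Uw ord_max; rewrite big_ord_recr /= opprD addrCA addrC -scalerBl.
have [||i|s [ns Us]] := IHn (fun i => w (wd i)) (tau * t)
    (fun i j => tau * mu (wd i) (wd j) + mu (wd i) ord_max * mu ord_max (wd j)).
- by move=> /spec_prime[].
- by move=> i j; apply: mD; [exact: mM|rewrite mulrC; exact: mM].
- have := submodD sU (submodZ tau sU (Uw (wd i))) (submodZ (mu (wd i) ord_max) sU Uz).
  rewrite big_ord_recr /=; set X := \sum_(j < n) _; set Z := \sum_(j < n) _.
  set T := \sum_(j < n) _; suff -> : T = tau *: X + mu (wd i) ord_max *: Z.
    rewrite !scalerBr scalerDr !scalerA [mu _ _ * tau]mulrC.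
    by rewrite !opprD !addrA subrK.
  rewrite !scaler_sumr -big_split; apply: eq_bigr => j _.
  by rewrite /= scalerDl !scalerA.
exists (s * tau); split; first by move=> /spec_prime[].
have Us' (j : 'I_n) : U ((s * tau) *: w (wd j)).
  by rewrite mulrC -scalerA; exact: submodZ.
have Usz : U ((s * tau) *: z).
  rewrite -scalerA -(subrK (\sum_(j < n) mu ord_max (wd j) *: w (wd j)) (tau *: z)).
  rewrite scalerDr; apply: submodD => //; first exact: submodZ.
  rewrite scaler_sumr; apply: submod_sum => // j.
  by rewrite scalerA mulrC -scalerA; exact: submodZ.
move=> i; have [ilt|] := ltnP i n.
  by rewrite (_ : i = wd (Ordinal ilt)) //; exact: val_inj.
move=> nlei; rewrite (_ : i = ord_max) //; apply: val_inj => /=.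
by apply/eqP; rewrite eqn_leq nlei -ltnS ltn_ord.
Qed.
End Nakayama.

(** * Maximal ideals and Krull dimension *)

Lemma exists_max_ideal (R : comPzRingType) (I : set R) : ideal I -> ~ I 1 ->
  exists m : Spec R, Max m /\ I `<=` (m : set R).
Proof.
move=> [I0 ID IM] nI1.
(* Zorn's lemma is applied to J through the union of I and J, so that the empty chain, whose union
   is the empty set, also satisfies [P]. *)
pose P (J : set R) := ideal (I `|` J) /\ ~ (I `|` J) 1.
have [F FP Ftot|J [[iJ nJ1] Jmax]] := @Zorn_bigcup R P.
  have mono X Y : F X -> F Y -> exists Z, [/\ F Z, X `<=` Z & Y `<=` Z].
    by move=> FX FY; case: (Ftot X Y FX FY) => XY;
      [exists Y|exists X]; split.
  split; last first.
    by move=> [//|[X FX X1]]; have [_] := FP _ FX; apply; right.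
  split=> [|x y|r x]; first by left.
  - move=> [Ix|[X FX Xx]] [Iy|[Y FY Yy]].
    + by left; exact: ID.
    + have [[_ XD _] _] := FP _ FY.
      by case: (XD x y (or_introl Ix) (or_intror Yy)); [left|right; exists Y].
    + have [[_ XD _] _] := FP _ FX.
      by case: (XD x y (or_intror Xx) (or_introl Iy)); [left|right; exists X].
    + have [Z [FZ XZ YZ]] := mono _ _ FX FY; have [[_ XD _] _] := FP _ FZ.
      case: (XD x y (or_intror (XZ _ Xx)) (or_intror (YZ _ Yy))); first by left.
      by right; exists Z.
  - move=> [Ix|[X FX Xx]]; first by left; exact: IM.
    have [[_ _ XM] _] := FP _ FX.
    by case: (XM r x (or_intror Xx)); [left|right; exists X].
have maxJ (B : set R) : ideal B -> ~ B 1 -> I `|` J `<=` B -> B = I `|` J.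
  move=> iB nB1 JB; apply: contrapT => neB; apply: (Jmax B); last first.
    suff IB : I `|` B = B by rewrite /P IB.
    by apply/seteqP; split=> [x [Ix|//]|x Bx]; [apply: JB; left|right].
  split; first by move=> x Jx; apply: JB; right.
  move=> BJ; apply: neB; apply/seteqP; split=> // x Bx.
  by right; exact: BJ.
have [J0 JD JM] := iJ.
have primeJ x y : (I `|` J) (x * y) -> (I `|` J) x \/ (I `|` J) y.
  move=> Jxy; have [|nJx] := pselect ((I `|` J) x); first by left.
  right; pose B : set R := [set z | exists j r, (I `|` J) j /\ z = j + r * x].
  have [[j [r [Jj one]]]|nB1] := pselect (B 1).
    rewrite -[y]mul1r one mulrDl; apply: JD; first by rewrite mulrC; exact: JM.
    by rewrite -mulrA; exact: JM.
  case: nJx; rewrite -(maxJ B) //.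
  - by exists 0, 1; rewrite mul1r add0r.
  - split=> [|s t [j [r [Jj ->]]] [j' [r' [Jj' ->]]]|r s [j [r' [Jj ->]]]].
    + by exists 0, 0; rewrite mul0r addr0.
    + by exists (j + j'), (r + r'); rewrite mulrDl addrACA; split=> //; exact: JD.
    + by exists (r * j), (r * r'); rewrite mulrDr mulrA; split=> //; exact: JM.
  - by move=> j Jj; exists j, 0; rewrite mul0r addr0.
exists (@PrimeIdeal R (I `|` J) iJ nJ1 primeJ); split.
  by move=> B iB nB1 JB /=; exact: maxJ.
by move=> x Ix /=; left.
Qed.

Lemma ideal_not_in_max (R : comPzRingType) (I : set R) : ideal I ->
  (forall m : Spec R, Max m -> exists s, I s /\ ~ spec_set m s) -> I 1.
Proof.
move=> iI cover; apply: contrapT => /(exists_max_ideal iI)[m [maxm Im]].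
by have [s [Is nms]] := cover m maxm; apply: nms; exact: Im.
Qed.

Section Dimension.
Variable T : topologicalType.
Implicit Types C Z : set T.

Lemma closure1_sub (x : T) (A : set T) :
  closed A -> A x -> closure [set x] `<=` A.
Proof.
by move=> /closure_id {2}-> Ax; apply: closureS => _ ->.
Qed.

Lemma irreducible_closure1 (x : T) : irreducible_set (closure [set x]).
Proof.
have xx : closure [set x] x by exact: subset_closure.
split; first by exists x.
by move=> A B cA cB /(_ _ xx)[Ax|Bx]; [left|right]; exact: closure1_sub.
Qed.

(** Noetherian induction: a closed set without a decomposition is nonempty and reducible, so it is
    covered by two proper closed subsets, one of which again has none. Iterating gives an infinite
    strictly descending chain. *)
Lemma noetherian_decomposition C : noetherian_space T -> closed C ->
  exists s : seq (set T),
    (forall Z, Z \in s -> [/\ closed Z, irreducible_set Z & Z `<=` C]) /\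
    (forall x, C x -> exists2 Z, Z \in s & Z x).
Proof.
move=> noeth clC; apply: contrapT => nC; apply: noeth.
pose bad D := closed D /\ ~ exists s : seq (set T),
  (forall Z, Z \in s -> [/\ closed Z, irreducible_set Z & Z `<=` D]) /\
  (forall x, D x -> exists2 Z, Z \in s & Z x).
have next D : exists D', bad D -> bad D' /\ D' `<` D.
  have [[clD nD]|] := pselect (bad D); last by exists D.
  have nirr : ~ irreducible_set D.
    move=> irrD; apply: nD; exists [:: D]; split=> [Z|x Dx].
      by rewrite inE => /eqP ->; split.
    by exists D => //; rewrite inE.
  have D0 : D !=set0.
    apply/set0P/negP => /eqP D0; apply: nD; exists [::]; split=> // x.
    by rewrite D0.
  have [A [B [clA clB DAB nDA nDB]]] : exists A B,
      [/\ closed A, closed B, D `<=` A `|` B, ~ D `<=` A & ~ D `<=` B].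
    apply: contrapT => nAB; apply: nirr; split=> // A B clA clB DAB.
    apply: contrapT => /not_orP[nDA nDB]; apply: nAB; exists A, B; by split.
  have [badA|nA] := pselect (bad (D `&` A)).
    exists (D `&` A) => _; split=> //; split; first exact: subIsetl.
    by move=> sub; apply: nDA => x /sub[].
  have [badB|nB] := pselect (bad (D `&` B)).
    exists (D `&` B) => _; split=> //; split; first exact: subIsetl.
    by move=> sub; apply: nDB => x /sub[].
  have good A' : closed A' -> ~ bad (D `&` A') -> exists s : seq (set T),
      (forall Z, Z \in s -> [/\ closed Z, irreducible_set Z & Z `<=` D `&` A']) /\
      (forall x, (D `&` A') x -> exists2 Z, Z \in s & Z x).
    move=> clA' nbad; apply: contrapT => ns; apply: nbad; split=> //.
    exact: closedI.
  have [s [sZ sA]] := good A clA nA; have [t [tZ tB]] := good B clB nB.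
  case: nD; exists (s ++ t); split=> [Z|x Dx].
    by rewrite mem_cat => /orP[/sZ|/tZ] [clZ irrZ ZD]; split=> // x /ZD[].
  have [Ax|Bx] := DAB x Dx.
    by have [Z Zs Zx] := sA x (conj Dx Ax); exists Z => //; rewrite mem_cat Zs.
  have [Z Zs Zx] := tB x (conj Dx Bx); exists Z => //.
  by rewrite mem_cat Zs orbT.
have [f fP] := choice next.
have bad_iter n : bad (iter n f C).
  by elim: n => [|n IHn]; [split|exact: (fP _ IHn).1].
exists (fun n => iter n f C); split=> n; first by have [] := bad_iter n.
exact: (fP _ (bad_iter n)).2.
Qed.

Fixpoint chain_top (t : nat) (Z : set T) : Prop :=
  [/\ closed Z, irreducible_set Z &
      if t is t'.+1 then exists2 Z', chain_top t' Z' & Z' `<` Z else True].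

(* dim C < t, where the empty set has dimension -1. *)
Definition dim_lt C t : Prop := forall Z, chain_top t Z -> ~ Z `<=` C.

Lemma chain_top_irr t Z : chain_top t Z -> closed Z /\ irreducible_set Z.
Proof. by case: t => [|t] []. Qed.

Lemma has_chain_top t Z : chain_top t Z -> has_chain T t.
Proof.
move=> tZ; suff [F [FZ Fi Flt]] : exists F : nat -> set T, [/\ F t = Z,
    forall i, (i <= t)%N -> closed (F i) /\ irreducible_set (F i) &
    forall i, (i < t)%N -> F i `<` F i.+1].
  exists (fun i => F i); split=> [i|i j]; first by apply: Fi; rewrite -ltnS.
  have : (j <= t)%N by rewrite -ltnS.
  elim: (nat_of_ord j) => // k IHk kt; rewrite ltnS leq_eqVlt => /orP[/eqP ->|ik].
    exact: Flt.
  have [sub nsub] := IHk (ltnW kt) ik; have [sub' _] := Flt k kt.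
  split=> [|s]; first exact: subset_trans sub sub'.
  by apply: nsub; exact: subset_trans sub' s.
elim: t Z tZ => [|t IHt] Z tZ.
  by exists (fun=> Z); split=> // i _; exact: chain_top_irr tZ.
have [clZ irrZ [Z' tZ' Z'Z]] := tZ; have [F [FZ Fi Flt]] := IHt _ tZ'.
exists (fun i => if (i <= t)%N then F i else Z); split=> [|i it|i it].
- by rewrite ltnn.
- by case: ifP => [/Fi|_].
- have {}it : (i <= t)%N by [].
  rewrite it; have [it'|] := ltnP i t; first exact: Flt.
  move=> ti; have -> : i = t by apply/eqP; rewrite eqn_leq it ti.
  by rewrite FZ.
Qed.

(** Bounded chain lengths make the supremum in nat a true upper bound. An empty space has the
    default value 0, and no chain there contradicts the claim. *)
Lemma dim_ltT C : finite_dimensional T -> dim_lt C (krull_dim T).+1.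
Proof.
move=> [d dP] Z /has_chain_top hZ _.
suff : ((krull_dim T).+1 <= krull_dim T)%N by rewrite ltnn.
apply: (@ge_supremum_Nmem _ _ 0%N _ _ _ hZ).
by apply: nat_supremums_neq0; exists d.
Qed.

Lemma dim_lt0 C x : closed C -> dim_lt C 0 -> ~ C x.
Proof.
move=> clC dC Cx; apply: (dC (closure [set x])).
  by split=> //; [exact: closed_closure|exact: irreducible_closure1].
exact: closure1_sub.
Qed.

Lemma dim_ltS C t : dim_lt C t -> dim_lt C t.+1.
Proof.
by move=> dC Z [_ _ [Z' tZ' [Z'Z _]]] ZC; apply: (dC Z') => // x /Z'Z /ZC.
Qed.

Lemma dim_ltW C t u : (t <= u)%N -> dim_lt C t -> dim_lt C u.
Proof.
by move=> /subnK <-; elim: (u - t)%N => // n IHn dC; exact/dim_ltS/IHn.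
Qed.

Lemma irreducible_cover Z (s : seq (set T)) : irreducible_set Z ->
  (forall W, W \in s -> closed W) ->
  (forall x, Z x -> exists2 W : set T, W \in s & W x) ->
  exists2 W : set T, W \in s & Z `<=` W.
Proof.
move=> [[z Zz] irrZ]; elim: s => [_ cov|W s IHs cls cov].
  by have [] := cov z Zz.
have cls' (V : set T) : V \in s -> closed V.
  by move=> Vs; apply: cls; rewrite inE Vs orbT.
have clbig : closed (\bigcup_(V in [set V | V \in s]) V).
  by apply: closed_bigcup; [exact: finite_seq|].
case: (irrZ W _ (cls _ (mem_head _ _)) clbig) => [x Zx|ZW|Zs].
- have [V + Vx] := cov x Zx; rewrite inE => /orP[/eqP <-|Vs]; first by left.
  by right; exists V.
- by exists W => //; rewrite inE eqxx.
- have [x /Zs[V Vs Vx]|V Vs ZV] := IHs cls'; first by exists V.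
  by exists V => //; rewrite inE Vs orbT.
Qed.

(* One point outside C1 is chosen on each irreducible component of C that is   *)
(* not contained in C1.                                                        *)
Lemma dim_lt_drop C C1 t : noetherian_space T -> closed C ->
  dim_lt C t.+1 -> dim_lt C1 t ->
  exists pts : seq T, (forall x, x \in pts -> ~ C1 x) /\
    forall C', C' `<=` C -> (forall x, x \in pts -> ~ C' x) -> closed C' ->
      dim_lt C' t.
Proof.
move=> noeth clC dC dC1.
have [s [sZ sC]] := noetherian_decomposition noeth clC.
have /choice[pt ptP] (Z : set T) : exists o : option T,
    match o with Some x => Z x /\ ~ C1 x | None => Z `<=` C1 end.
  have [ZC1|/existsNP[x /not_implyP[Zx nx]]] := pselect (Z `<=` C1).
    by exists None.
  by exists (Some x).
exists (pmap pt s); split=> [x|C' C'C avoid clC' Z tZ ZC'].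
  rewrite mem_pmap => /mapP[Z _ xE]; have := ptP Z.
  by rewrite -xE => -[].
have [clZ irrZ] := chain_top_irr tZ.
have [|x Zx|W Ws ZW] := irreducible_cover (s := s) irrZ.
- by move=> W /sZ[].
- exact/sC/C'C/ZC'.
have [clW irrW WC] := sZ W Ws.
have := ptP W; case ptW : (pt W) => [x|] => [[Wx nC1x]|WC1]; last first.
  by apply: (dC1 Z) => //; exact: subset_trans WC1.
apply: (dC W) => //; split=> //; exists Z => //; split=> // WZ.
apply: (avoid x); last exact/ZC'/WZ.
by rewrite mem_pmap; apply/mapP; exists W.
Qed.

End Dimension.

(** * Elimination of columns over a module-finite algebra *)

Definition unit_stable_range (A : pzRingType) : Prop := forall a b x y : A,
  x * a + y * b = 1 -> exists c u, u * (a + c * b) = 1.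

Lemma unit_stable_range_mx1 (A : pzRingType) : unit_stable_range A ->
  forall a b x y : 'M[A]_1, x *m a + y *m b = 1%:M ->
  exists c u : 'M[A]_1, u *m (a + c *m b) = 1%:M.
Proof.
move=> sr a b x y /matrixP/(_ 0 0); rewrite !mxE !big_ord1 => /sr[c [u uP]].
exists c%:M, u%:M; apply/matrixP=> i j; rewrite !ord1 !mxE big_ord1 !mxE.
by rewrite big_ord1 !mxE !eqxx !mulr1n uP.
Qed.

(* The row l completing (g G1) to a left invertible matrix can be traded for   *)
(* the row (-1, Gamma D), which kills the column (Gamma D; 1).                 *)
Lemma absorb_column (A : pzRingType) (p c : nat) (g : 'cV[A]_p)
    (G1 : 'M[A]_(p, c)) (l : 'rV[A]_(1 + c)) (V : 'M[A]_(1 + c, p))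
    (xi : 'cV[A]_(1 + c)) (D B : 'M[A]_c) (rho : 'M[A]_(c, p)) :
  unit_stable_range A ->
  V *m row_mx g G1 + xi *m l = 1%:M -> B *m D + rho *m G1 = 1%:M ->
  exists Gam V', V' *m (G1 + g *m (Gam *m D)) = 1%:M :> 'M_c.
Proof.
move=> sr; set G := row_mx g G1 => VG BD.
have [f fE] : exists f : 'M_1, f = 1%:M - l *m xi by exists (1%:M - l *m xi).
pose xx := usubmx xi; pose x1 := dsubmx xi.
pose lx := lsubmx l; pose l1 := rsubmx l.
have xiE : xi = col_mx xx x1 by rewrite vsubmxK.
have lE : l = row_mx lx l1 by rewrite hsubmxK.
have GxiE : G *m xi = g *m xx + G1 *m x1 by rewrite xiE mul_row_col.
pose theta := lx - l1 *m rho *m g.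
have lxiE : l *m xi = lx *m xx + l1 *m x1 by rewrite lE xiE mul_row_col.
pose w := B *m D *m x1 + rho *m (G *m xi).
have wE : w = x1 + rho *m g *m xx.
  rewrite /w GxiE mulmxDr !mulmxA addrCA -mulmxDl BD mul1mx addrC.
  by [].
have [|c0 [u uP]] := unit_stable_range_mx1 sr (x := - theta) (y := 1%:M)
    (a := f - xx) (b := (1%:M + theta) *m f + l1 *m w).
  rewrite mul1mx mulNmx mulmxBr opprB mulmxDl mul1mx.
  rewrite [f + _]addrC -!addrA addKr addrCA.
  suff -> : theta *m xx + l1 *m w = l *m xi by rewrite fE subrK.
  by rewrite lxiE wE mulmxDr mulmxBl !mulmxA addrCA addrC subrK addrC.
pose Gam := c0 *m l1 *m B.
pose mu1 := c0 *m l1 *m rho; pose mu2 := c0 *m (1%:M + theta).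
pose l' := row_mx (- 1%:M) (Gam *m D) : 'rV_(1 + c).
have l'xi : l' *m xi = - xx + Gam *m D *m x1.
  by rewrite {1}xiE mul_row_col mulNmx mul1mx.
have c0w : c0 *m (l1 *m w) = Gam *m D *m x1 + mu1 *m (G *m xi).
  by rewrite /w !mulmxDr !mulmxA.
(* Modulo the rows of G, the row l' equals (l' xi) l, while f l and (G xi) l vanish. Hence t l is l'
   there, where t is the element on the left, and its left inverse u expresses l through the rows of
   G and l'. *)
have tE : f - xx + c0 *m ((1%:M + theta) *m f + l1 *m w) =
    f + l' *m xi + mu1 *m (G *m xi) + mu2 *m f.
  by rewrite mulmxDr c0w l'xi mulmxA -/mu2 [X in _ + X]addrC !addrA.
have fl : f *m l = l *m V *m G.
  by rewrite fE mulmxBl mul1mx -[l in X in X - _]mulmx1 -VG mulmxDr !mulmxA addrK.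
have tl : (f - xx + c0 *m ((1%:M + theta) *m f + l1 *m w)) *m l =
    (l *m V - l' *m V + mu1 - mu1 *m G *m V + mu2 *m l *m V) *m G + l'.
  have xl : xi *m l = 1%:M - V *m G by rewrite -VG addrC addKr.
  rewrite tE !mulmxDl fl -!(mulmxA _ _ l) fl !mulmxA.
  rewrite -(mulmxA l') -(mulmxA (mu1 *m G)) xl !mulmxBr !mulmx1 !mulNmx -/mu2.
  by rewrite !mulmxA !addrA [RHS]addrC !addrA [l' + _]addrC.
pose kap := l *m V - l' *m V + mu1 - mu1 *m G *m V + mu2 *m l *m V.
have lE' : l = u *m kap *m G + u *m l' by rewrite -mulmxA -mulmxDr -tl mulmxA uP mul1mx.
exists Gam, (dsubmx (V + xi *m u *m kap)).
pose C := col_mx (Gam *m D) (1%:M : 'M_c).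
have GC : G *m C = G1 + g *m (Gam *m D) by rewrite mul_row_col mulmx1 addrC.
have l'C : l' *m C = 0 by rewrite mul_row_col mulNmx mul1mx mulmx1 addNr.
rewrite -GC mul_dsub_mx mulmxA.
have -> : (V + xi *m u *m kap) *m G *m C = C.
  rewrite -[RHS]mul1mx -VG {1}lE' mulmxDr !mulmxDl -!mulmxA l'C !mulmx0 addr0.
  by rewrite !mulmxA.
by rewrite col_mxKd.
Qed.

(** * The residue algebra E / mE *)

Section Extension.
Variables (R : comPzRingType) (E : centralAlgType R) (m : Spec R).

Definition ext_set : set E := [set x | exists s : seq (R * E),
  (forall u, u \in s -> spec_set m u.1) /\ x = \sum_(u <- s) alg_map E u.1 * u.2].

Lemma ext_setM r x : spec_set m r -> ext_set (alg_map E r * x).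
Proof.
move=> mr; exists [:: (r, x)]; rewrite big_seq1; split=> // u.
by rewrite inE => /eqP ->.
Qed.

Lemma ext_setD x y : ext_set x -> ext_set y -> ext_set (x + y).
Proof.
move=> [s [sm ->]] [t [tm ->]]; exists (s ++ t); rewrite big_cat; split=> // u.
by rewrite mem_cat => /orP[/sm|/tm].
Qed.

Lemma ext_set_ind (P : E -> Prop) :
  P 0 -> (forall x y, P x -> P y -> P (x + y)) ->
  (forall r x, spec_set m r -> P (alg_map E r * x)) -> forall x, ext_set x -> P x.
Proof.
move=> P0 PD PM _ [s [sm ->]]; rewrite big_seq; apply: big_ind => // u /sm.
exact: PM.
Qed.

Lemma left_ideal_ext : left_ideal ext_set.
Proof.
have ext0 : ext_set 0 by exists [::]; rewrite big_nil.
split=> // [|a]; first exact: ext_setD.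
apply: (ext_set_ind (P := fun x => ext_set (a * x))) =>
  [|y z yE zE|r y mr]; rewrite ?mulr0 ?mulrDr //.
  exact: ext_setD.
by rewrite mulrA -alg_mapC -mulrA; exact: ext_setM.
Qed.

Lemma right_ideal_ext x a : ext_set x -> ext_set (x * a).
Proof.
move: x; apply: (ext_set_ind (P := fun x => ext_set (x * a))) =>
  [|y z yE zE|r y mr]; rewrite ?mul0r ?mulrDl //.
- exact: left_ideal0 left_ideal_ext.
- exact: ext_setD.
- by rewrite -mulrA; exact: ext_setM.
Qed.

Definition ext_ideal := TwoSidedIdeal left_ideal_ext right_ideal_ext.

Definition res_ring : pzRingType := quo ext_ideal.
Definition res : {rmorphism E -> res_ring} := to_quo ext_ideal.

Lemma res_eq0 x : res x = 0 <-> ext_set x.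
Proof. exact: (to_quo_eq0 ext_ideal). Qed.

Lemma res_surj (q : res_ring) : exists x, res x = q.
Proof. by have [x ->] := to_quo_surj q; exists x. Qed.

Definition res_map : {rmorphism R -> res_ring} := res \o alg_map E.

Fact res_mapC r q : res_map r * q = q * res_map r.
Proof.
by have [x <-] := res_surj q; rewrite /= -!rmorphM alg_mapC.
Qed.

Definition res_alg := CentralAlg res_mapC.

Lemma res_map0 r : spec_set m r -> alg_map res_alg r = 0.
Proof. by move=> mr; apply/res_eq0; rewrite -[alg_map E r]mulr1; exact: ext_setM. Qed.

Hypotheses (maxm : Max m) (finE : module_finite E).

Lemma module_finite_res : module_finite res_alg.
Proof.
have [n [v vP]] := finE; exists n, (fun i => res (v i)) => q.
have [x <-] := res_surj q; have [c ->] := vP x; exists c.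
by rewrite rmorph_sum; apply: eq_bigr => i _; rewrite rmorphM.
Qed.

Lemma res_stable_range : unit_stable_range res_ring.
Proof.
move=> a b x y xy; have fin := module_finite_res.
have noeth := alg_noetherian maxm fin res_map0.
have art := alg_artinian maxm fin res_map0.
have [c [u [uP _]]] := stable_range_one noeth art xy.
by exists c, u.
Qed.

Lemma res_mx_surj p q (M : 'M[res_ring]_(p, q)) : exists M', map_mx res M' = M.
Proof.
exists (map_mx (@quo_rep _ ext_ideal) M); apply/matrixP=> i j; rewrite !mxE.
have [x ->] := to_quo_surj (M i j); apply/to_quo_eq; exact: quo_repP.
Qed.

End Extension.

(** * Lifting left inverses from E / mE *)

Section ResidualInvertibility.
Variables (R : comPzRingType) (E : centralAlgType R) (m : Spec R).
Hypothesis finE : module_finite E.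

Lemma nakayama_fin (V : lmodType R) (U : set V) (I : finType) (w : I -> V)
    (mu : I -> I -> R) : submod U -> (forall i j, spec_set m (mu i j)) ->
  (forall i, U (w i - \sum_j mu i j *: w j)) ->
  exists s, ~ spec_set m s /\ forall i, U (s *: w i).
Proof.
move=> sU mmu Uw.
have [||i|s [ns Us]] := nakayama (m := m) sU (n := #|I|)
  (w := fun i => w (enum_val i)) (t := 1)
  (mu := fun i j => mu (enum_val i) (enum_val j)).
- exact: spec_proper.
- by move=> i j.
- rewrite scale1r.
  have := Uw (enum_val i).
  by rewrite (reindex _ (onW_bij _ (@enum_val_bij I))).
by exists s; split=> // i; rewrite -(enum_rankK i).
Qed.

(** Nakayama over R, for E^c modulo the row space of N. As N is 1 modulo mE, each R-generator [w] of
    E^c is, modulo that row space, a combination of the generators with coefficients in m. So some s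
    outside m carries the unit vectors into the row space. *)
Lemma left_invertible_lift c (N : 'M[E]_c) : map_mx (res E m) N = 1%:M ->
  exists s (M : 'M[E]_c), ~ spec_set m s /\ M *m N = (alg_map E s)%:M.
Proof.
move=> N1; have [n [e eP]] := finE.
pose V := {ffun 'I_c -> alg_mod E}.
pose U : set V := [set x | exists y : 'rV[E]_c, forall j, x j = (y *m N) 0 j].
have sU : submod U.
  split=> [|x x' [y xy] [y' xy']|r x [y xy]].
  - by exists 0 => j; rewrite mul0mx mxE ffunE.
  - by exists (y + y') => j; rewrite mulmxDl mxE ffunE xy xy'.
  - exists (\row_i (alg_map E r * y 0 i)) => j.
    rewrite ffunE xy -[LHS]/(alg_map E r * _) !mxE mulr_sumr.
    by apply: eq_bigr => i _; rewrite mxE mulrA.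
pose w (a : 'I_n * 'I_c) : V := [ffun j => if j == a.2 then e a.1 else 0].
pose comb (x : E) := exists mu : 'I_n -> R,
  (forall k, spec_set m (mu k)) /\ x = \sum_k mu k *: e k :> alg_mod E.
have extP x : ext_set m x -> comb x.
  have [m0 mD mM] := spec_ideal m.
  move: x; apply: (ext_set_ind (P := comb)) =>
    [|x y [mu [mmu ->]] [nu [mnu ->]]|r z mr].
  - by exists (fun=> 0); split=> //; rewrite big1 // => k _; rewrite scale0r.
  - exists (fun k => mu k + nu k); split=> [k|]; first exact: mD.
    by rewrite -[LHS]big_split; apply: eq_bigr => k _; rewrite scalerDl.
  - have [d zE] := eP z; exists (fun k => d k * r); split=> [k|]; first exact: mM.
    rewrite -[LHS]/(r *: (z : alg_mod E)) zE scaler_sumr; apply: eq_bigr => k _.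
    by rewrite scalerA mulrC.
have /choice[mu muP] (ab : ('I_n * 'I_c) * 'I_c) : exists mu : 'I_n -> R,
    (forall k, spec_set m (mu k)) /\
    e ab.1.1 * ((ab.1.2 == ab.2)%:R - N ab.1.2 ab.2) = \sum_k mu k *: e k :> alg_mod E.
  apply: extP; apply: left_idealM; first exact: left_ideal_ext.
  apply/res_eq0; rewrite rmorphB rmorph_nat; apply/eqP; rewrite subr_eq0.
  by apply/eqP; move/matrixP: N1 => /(_ ab.1.2 ab.2); rewrite !mxE => ->.
have [||s [ns Us]] := nakayama_fin (w := w)
    (mu := fun a b => mu (a, b.2) b.1) sU.
- by move=> a b; have [] := muP (a, b.2).
- move=> a; exists (\row_j w a j) => j.
  rewrite [RHS]mxE [RHS](bigD1 a.2) //= [X in _ = _ + X]big1 ?addr0; last first.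
    by move=> i /negPf ia; rewrite mxE ffunE ia mul0r.
  rewrite mxE !ffunE eqxx sum_ffunE.
  rewrite [X in _ - X](_ : _ = \sum_k mu (a, j) k *: e k); last first.
    rewrite -(pair_bigA _ (fun k i => (mu (a, i) k *: w (k, i)) j)) /=.
    apply: eq_bigr => k _; rewrite (bigD1 j) //= big1 ?addr0 => [|i /negPf ij].
      by rewrite !ffunE /= eqxx.
    by rewrite !ffunE /= eq_sym ij scaler0.
  have [_ <-] := muP (a, j); rewrite /= mulrBr opprB addrCA eq_sym.
  by case: eqP => _; rewrite ?mulr1 ?mulr0 subrr addr0.
have [d oneE] := eP 1.
have /choice[Y YP] (i : 'I_c) : exists y : 'rV[E]_c,
    forall j, (if j == i then alg_map E s else 0) = (y *m N) 0 j.
  suff [y yP] : U (s *: \sum_k d k *: w (k, i)).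
    exists y => j; rewrite -yP ffunE sum_ffunE.
    have -> : \sum_k (d k *: w (k, i)) j = if j == i then 1 else 0 :> alg_mod E.
      case: eqP => [->|/eqP/negPf ji].
        by rewrite [RHS]oneE; apply: eq_bigr => k _; rewrite !ffunE /= eqxx.
      by rewrite big1 // => k _; rewrite !ffunE /= ji scaler0.
    case: eqP => _; last by rewrite scaler0.
    by rewrite -[RHS]/(alg_map E s * 1) mulr1.
  rewrite scaler_sumr; apply: submod_sum => // k.
  by rewrite scalerA mulrC -scalerA; exact: submodZ.
exists s, (\matrix_(i, j) Y i 0 j); split=> //; apply/matrixP=> i j.
rewrite mxE [X in X = _](_ : _ = (Y i *m N) 0 j); last first.
  by rewrite mxE; apply: eq_bigr => k _; rewrite !mxE.
by rewrite -YP mxE eq_sym; case: eqP.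
Qed.

End ResidualInvertibility.

(** * Deficiency of a matrix at a prime *)

Section Deficiency.
Variables (R : comPzRingType) (E : centralAlgType R).
Implicit Types m : Spec R.

(* Over a field this says that T has rank at least c - k modulo m. *)
Definition deficient (k p c : nat) (T : 'M[E]_(p, c)) m : Prop :=
  exists s (L : 'M[E]_(k, c)) (U : 'M[E]_(c, p)) (W : 'M[E]_(c, k)),
    ~ spec_set m s /\ U *m T + W *m L = (alg_map E s)%:M.

Lemma deficient_add k j p c (T : 'M[E]_(p, c)) m :
  deficient k T m -> deficient (k + j) T m.
Proof.
move=> [s [L [U [W [ns UT]]]]]; exists s, (col_mx L 0), U, (row_mx W 0).
by rewrite mul_row_col mul0mx addr0.
Qed.

Lemma deficientW k k' p c (T : 'M[E]_(p, c)) m : (k <= k')%N ->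
  deficient k T m -> deficient k' T m.
Proof. by move=> /subnKC <-; exact: deficient_add. Qed.

(** Right multiplication by the block column (G; 1) turns (x | T1) into T1 + x G, and the lower c
    rows of the relation still have value s. *)
Lemma deficient_rcol k p c (x : 'cV[E]_p) (T1 : 'M[E]_(p, c)) (G : 'rV[E]_c) m :
  deficient k (row_mx x T1) m -> deficient k (T1 + x *m G) m.
Proof.
move=> [s [L [U [W [ns UT]]]]].
pose C := col_mx G (1%:M : 'M_c).
exists s, (L *m C), (dsubmx (U : 'M_(1 + c, p))), (dsubmx (W : 'M_(1 + c, k))).
split=> //; have := congr1 (fun M : 'M_(1 + c) => dsubmx (M *m C)) UT.
rewrite /= mulmxDl -!mulmxA mul_row_col mulmx1 [x *m G + _]addrC.
rewrite -[(alg_map E s)%:M *m C]/((alg_map E s)%:M *m col_mx G 1%:M).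
rewrite mul_scalar_mx scale_col_mx col_mxKd scalemx1 => <-.
by rewrite linearD /= !mul_dsub_mx.
Qed.

Hypothesis finE : module_finite E.

(** With [deficient_res], this says that deficiency at a maximal ideal can be tested over E / mE. *)
Lemma deficient_lift k p c (T : 'M[E]_(p, c)) (L : 'M[E]_(k, c))
    (U : 'M[E]_(c, p)) (W : 'M[E]_(c, k)) m :
  map_mx (res E m) (U *m T + W *m L) = 1%:M -> deficient k T m.
Proof.
move=> /(left_invertible_lift finE)[s [M [ns MN]]].
exists s, L, (M *m U), (M *m W); split=> //.
by rewrite -MN mulmxDr !mulmxA.
Qed.

Lemma deficient_res k p c (T : 'M[E]_(p, c)) m : Max m -> deficient k T m ->
  exists (L : 'M[E]_(k, c)) (U : 'M[E]_(c, p)) (W : 'M[E]_(c, k)),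
  map_mx (res E m) (U *m T + W *m L) = 1%:M.
Proof.
move=> maxm [s [L [U [W [ns UT]]]]]; have [t ts] := max_inv maxm ns.
exists L, ((alg_map E t)%:M *m U), ((alg_map E t)%:M *m W).
rewrite -!mulmxA -mulmxDr UT -scalar_mxM -rmorphM map_scalar_mx.
congr (_%:M); apply/eqP; rewrite -subr_eq0 -[X in _ - X](rmorph1 (res E m)).
rewrite -rmorphB -[X in _ - X](rmorph1 (alg_map E)) -rmorphB.
exact/eqP/(res_map0 E ts).
Qed.

(** One residue has to serve all k. It is found for the least k0 such that k0 + 1 rows suffice, by
    giving up the first of these rows through [absorb_column]; the other k follow because deficiency
    is monotone in k. *)
Lemma local_step p c (x : 'cV[E]_p) (T1 : 'M[E]_(p, c)) (D B : 'M[E]_c)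
    (rho : 'M[E]_(c, p)) m : Max m -> B *m D + rho *m T1 = 1%:M ->
  exists Gam0 : 'rV[E]_c, forall Gam : 'rV[E]_c,
    map_mx (res E m) Gam = map_mx (res E m) Gam0 -> forall k,
    deficient k.+1 (row_mx x T1) m -> deficient k (T1 + x *m (Gam *m D)) m.
Proof.
move=> maxm BD; set T := row_mx x T1.
have [ex|no] := pselect (exists k, `[< deficient k.+1 T m >]); last first.
  by exists 0 => Gam _ k dk; case: no; exists k; apply/asboolP.
case: (ex_minnP ex) => k0 /asboolP dk0 k0min.
have [L [U [W /= UT]]] := deficient_res maxm dk0.
pose l := usubmx (L : 'M_(1 + k0, 1 + c)); pose L2 := dsubmx (L : 'M_(1 + k0, 1 + c)).
pose xi := lsubmx (W : 'M_(1 + c, 1 + k0)); pose W2 := rsubmx (W : 'M_(1 + c, 1 + k0)).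
have [||Gam [V VP]] := @absorb_column _ _ _ (map_mx (res E m) (col_mx x (lsubmx L2)))
    (map_mx (res E m) (col_mx T1 (rsubmx L2))) (map_mx (res E m) l)
    (map_mx (res E m) (row_mx U W2)) (map_mx (res E m) xi)
    (map_mx (res E m) D) (map_mx (res E m) B) (map_mx (res E m) (row_mx rho 0))
    (res_stable_range maxm finE).
- rewrite -map_row_mx -!map_mxM -map_mxD -UT; congr (map_mx _ _).
  rewrite -block_mxEh /block_mx hsubmxK mul_row_col -addrA; congr (_ + _).
  rewrite addrC -mul_row_col hsubmxK vsubmxK; reflexivity.
- rewrite -!map_mxM -map_mxD mul_row_col mul0mx addr0 BD; exact: map_mx1.
have [Gam0 Gam0E] := res_mx_surj Gam; have [V0 V0E] := res_mx_surj V.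
exists Gam0 => Gam' Gam'E k dk.
apply: (@deficientW k0); first exact/k0min/asboolP.
apply: (@deficient_lift _ _ _ _ (rsubmx L2 + lsubmx L2 *m (Gam' *m D))
  (lsubmx V0) (rsubmx V0)).
rewrite -mul_row_col hsubmxK -VP -V0E -Gam0E -Gam'E -!map_mxM -map_mxD -map_mxM.
by rewrite mul_col_mx add_col_mx.
Qed.

Lemma ext_crt c (l : seq (Spec R)) (F : Spec R -> 'rV[E]_c) :
  (forall m, m \in l -> Max m) ->
  exists G : 'rV[E]_c, forall m, m \in l ->
    map_mx (res E m) G = map_mx (res E m) (F m).
Proof.
elim: l => [|m l IHl] maxl; first by exists 0.
have [m' m'l|G GP] := IHl; first by apply: maxl; rewrite inE m'l orbT.
have maxm := maxl m (mem_head _ _).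
have [ml|nml] := boolP (m \in l).
  by exists G => m'; rewrite inE => /orP[/eqP ->|]; exact: GP.
have [r [r1 rl]] : exists r, spec_set m (r - 1) /\
    forall m', m' \in l -> spec_set m' r.
  have [m0 mD mM] := spec_ideal m.
  elim: l maxl nml {IHl G GP} => [|m' l IHl] maxl; first by
    exists 1; rewrite subrr; split.
  rewrite inE negb_or => /andP[mm' ml].
  have [|//|r [r1 rl]] := IHl.
    move=> m2; rewrite inE => /orP[/eqP -> //|m2l].
    by apply: maxl; rewrite !inE m2l !orbT.
  have [x [m'x x1]] : exists x, spec_set m' x /\ spec_set m (x - 1).
    have maxm' : Max m' by apply: maxl; rewrite !inE eqxx orbT.
    have [y [m'y nmy]] : exists y, spec_set m' y /\ ~ spec_set m y.
      apply: contrapT => nex; move/eqP: mm'; apply.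
      have sub : spec_set m' `<=` spec_set m.
        by move=> y m'y; apply: contrapT => nmy; apply: nex; exists y.
      have := maxm' _ (spec_ideal m) (@spec_proper _ m) sub.
      case: (m) (m') => [? i1 p1 q1] [? i2 p2 q2] /= e; subst.
      by congr PrimeIdeal; exact: Prop_irrelevance.
    have [s sy] := max_inv maxm nmy; exists (s * y); split=> //.
    by have [_ _ m'M] := spec_ideal m'; exact: m'M.
  exists (x * r); split=> [|m2].
    rewrite (_ : x * r - 1 = x * (r - 1) + (x - 1)); last by ring.
    by apply: mD => //; exact: mM.
  rewrite inE => /orP[/eqP ->|/rl]; have [_ _ m2M] := spec_ideal m2.
    by rewrite mulrC; have [_ _ m'M] := spec_ideal m'; exact: m'M.
  exact: m2M.
(* As r is 1 modulo m and 0 modulo the members of l, this corrects G at m only. *)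
exists (G + (alg_map E r)%:M *m (F m - G)) => m'.
rewrite inE map_mxD map_mxM map_scalar_mx map_mxB => /orP[/eqP ->|m'l].
  have -> : res E m (alg_map E r) = 1.
    apply/eqP; rewrite -subr_eq0 -[X in _ - X](rmorph1 (res E m)).
    rewrite -rmorphB -[X in _ - X](rmorph1 (alg_map E)) -rmorphB.
    exact/eqP/(res_map0 E r1).
  by rewrite mul1mx addrC subrK.
have -> : res E m' (alg_map E r) = 0 by exact: (res_map0 E (rl _ m'l)).
by rewrite GP // mul_scalar_mx scale0r addr0.
Qed.

End Deficiency.

Lemma closed_zariski (R : comPzRingType) (A : set R) : closed (zariski_closed A).
Proof.
rewrite -[zariski_closed A]setCK closedC.
by rewrite /open /=; exists A; rewrite setCK.
Qed.

(** * Induction on the number of columns *)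

Section StableColumns.
Variables (R : comPzRingType) (E : centralAlgType R) (Y : set (Spec R)).
Hypotheses (finE : module_finite E) (Ymax : Y `<=` @Max R).
Hypothesis noethY : noetherian_space (set_type Y).
Hypothesis Ycover : forall m, Max m -> ~ Y m ->
  exists s, ~ spec_set m s /\ alg_map E s = 0.

Definition deficiency_locus k p c (T : 'M[E]_(p, c)) : set (set_type Y) :=
  [set m | ~ deficient k T (set_val m)].

(** The locus is the trace on Y of V(A), where A collects the values s of all completions of T by k
    rows. *)
Lemma closed_deficiency_locus k p c (T : 'M[E]_(p, c)) :
  closed (deficiency_locus k T).
Proof.
pose A : set R := [set s | exists (L : 'M[E]_(k, c)) U W,
  U *m T + W *m L = (alg_map E s)%:M].
have -> : deficiency_locus k T = set_val @^-1` zariski_closed A.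
  apply/seteqP; split=> m /= mT => [s [L [U [W UT]]]|[s [L [U [W [ns UT]]]]]].
    by apply: contrapT => ns; apply: mT; exists s, L, U, W.
  by apply/ns/mT; exists L, U, W.
have cont := @initial_continuous (set_type Y) (Spec R) set_val.
by move/continuous_closedP: cont => /(_ _ (@closed_zariski R A)).
Qed.

Lemma stable_columns n p (X : 'M[E]_(p, n)) (v : 'cV[E]_p) (a b : 'M[E]_1)
    (rho : 'rV[E]_p) : b *m a + rho *m v = 1%:M ->
  (forall k, (k <= n)%N -> dim_lt (deficiency_locus k (row_mx X v)) (n - k)) ->
  exists (e : 'cV[E]_n) (rho' : 'rV[E]_p),
    rho' *m (v + X *m (e *m a)) = 1%:M.
Proof.
elim: n X v b rho => [|n IHn] X v b rho bav dimT.
  pose J : set R := [set s | exists r : 'rV[E]_p, r *m v = (alg_map E s)%:M].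
  have [r rv] : J 1.
    apply: ideal_not_in_max => [|m maxm].
      split=> [|s t [r rP] [u uP]|s t [r rP]].
      - by exists 0; rewrite mul0mx rmorph0 raddf0.
      - by exists (r + u); rewrite mulmxDl rP uP !raddfD.
      - exists ((alg_map E s)%:M *m r).
        by rewrite -mulmxA rP -scalar_mxM rmorphM.
    have [Ym|/(Ycover maxm)[s [ns s0]]] := pselect (Y m); last first.
      by exists s; split=> //; exists 0; rewrite mul0mx s0 raddf0.
    have mY : m \in Y by exact/mem_set.
    have /contrapT[s [L [U [W [ns UT]]]]] := @dim_lt0 (set_type Y) _ (SigSub mY)
      (@closed_deficiency_locus 0 _ _ (row_mx X v)) (dimT 0%N isT).
    exists s; split=> //; exists U; move: UT.
    rewrite (flatmx0 L) mulmx0 addr0 => /(congr1 (fun M => M *m col_mx 0 1%:M)).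
    rewrite -mulmxA mul_row_col mulmx0 add0r mulmx1 => ->.
    rewrite mul_scalar_mx scale_col_mx scaler0 scalemx1.
    apply/matrixP=> i j; rewrite mxE; case: splitP => [[]//|k ik].
    by rewrite !mxE -!val_eqE /= ik.
  exists 0, r; rewrite mul0mx mulmx0 addr0 rv; congr (_%:M); exact: rmorph1.
pose x := lsubmx (X : 'M_(p, 1 + n)); pose X1 := rsubmx (X : 'M_(p, 1 + n)).
pose T1 := row_mx X1 v; pose T : 'M_(p, 1 + (n + 1)) := row_mx x T1.
have TE : row_mx X v = T.
  have := @row_mxA E p 1 n 1 x X1 v; rewrite /= hsubmxK => e.
  by rewrite /T e castmx_id.
(* The factor diag(1, a) allows v to change only by x G2 a, as the conclusion requires; [B] and (0;
   rho) give the relation that [local_step] asks of it. *)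
pose D : 'M[E]_(n + 1) := block_mx 1%:M 0 0 a.
pose B : 'M[E]_(n + 1) := block_mx 1%:M 0 (- rho *m X1) b.
have BD : B *m D + col_mx 0 rho *m T1 = 1%:M.
  rewrite mulmx_block mul_col_row !mulmx0 !mul0mx !mul1mx mulmx1.
  rewrite !addr0 !add0r add_block_mx !addr0 mulNmx addNr bav.
  by rewrite -scalar_mx_block.
have /choice[Gam0 Gam0P] (m : Spec R) : exists Gam0 : 'rV[E]_(n + 1),
    Max m -> forall Gam : 'rV[E]_(n + 1),
    map_mx (res E m) Gam = map_mx (res E m) Gam0 -> forall k,
    deficient k.+1 T m -> deficient k (T1 + x *m (Gam *m D)) m.
  have [maxm|nmaxm] := pselect (Max m); last by exists 0.
  by have [G GP] := local_step finE x maxm BD; exists G.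
(* At these points T has deficiency at most k + 1, so the prescribed residues remove them from the
   new k-th locus, which lies inside the old one. Its dimension bound then drops from n + 1 - k to n
   - k. *)
have /choice[pts ptsP] (k : 'I_n.+1) : exists pts : seq (set_type Y),
    (forall m, m \in pts -> ~ deficiency_locus k.+1 T m) /\
    forall C', C' `<=` deficiency_locus k T -> (forall m, m \in pts -> ~ C' m) ->
      closed C' -> dim_lt C' (n - k).
  apply: dim_lt_drop => //; first exact: closed_deficiency_locus.
    by rewrite -subSn -?TE; [apply: dimT; rewrite ltnW|rewrite -ltnS].
  by rewrite -subSS -TE; exact: dimT.
have [m|Gam GamP] := @ext_crt _ E (n + 1)
    (undup [seq set_val m | m <- flatten [seq pts k | k <- enum 'I_n.+1]]) Gam0.
  rewrite mem_undup => /mapP[y _ ->]; apply: Ymax; exact: set_valP.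
pose G1 := lsubmx Gam; pose G2 := rsubmx Gam.
have GamE : Gam = row_mx G1 G2 by rewrite hsubmxK.
have T'E : T1 + x *m (Gam *m D) = row_mx (X1 + x *m G1) (v + x *m (G2 *m a)).
  rewrite GamE mul_row_block !mulmx1 !mulmx0 addr0 add0r mul_mx_row.
  by rewrite add_row_mx.
have [|k kn|e [r er]] := IHn (X1 + x *m G1) (v + x *m (G2 *m a))
    (b - rho *m x *m G2) rho.
- by rewrite mulmxBl mulmxDr !mulmxA addrACA addNr addr0.
- rewrite -T'E; have kn' : (k < n.+1)%N by [].
  have [ptsk dimk] := ptsP (Ordinal kn'); apply: dimk => /=.
  + by move=> m /= ndef def; apply: ndef; exact: deficient_rcol.
  + move=> m mk /=; apply; apply: Gam0P; first exact/Ymax/set_valP.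
      apply: GamP; rewrite mem_undup; apply/map_f/flattenP.
      exists (pts (Ordinal kn')) => //; apply: map_f; exact: mem_enum.
    by apply: contrapT; exact: ptsk mk.
  + exact: closed_deficiency_locus.
(* The coefficient of x collects G2 from the new v and G1 e from the new columns X1 + x G1. *)
exists (col_mx (G2 + G1 *m e) e), r; rewrite -er; congr (_ *m _).
have XE : X = row_mx x X1 by rewrite hsubmxK.
have -> : X *m (col_mx (G2 + G1 *m e) e *m a) =
    x *m ((G2 + G1 *m e) *m a) + X1 *m (e *m a).
  by rewrite -mul_row_col -mul_col_mx -XE.
rewrite !(mulmxDl, mulmxDr) !mulmxA -!addrA.
by congr (_ + (_ + _)); exact: addrC.
Qed.

End StableColumns.

(** * Cancellation by elementary automorphisms *)

Definition linear_of (T : pzRingType) (V W : lmodType T) (f : V -> W)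
    (lf : linear f) : {linear V -> W} :=
  HB.pack f (GRing.isLinear.Build T V W *:%R f lf).

Lemma inj_surj_bij (V W : Type) (f : V -> W) :
  injective f -> (forall y, exists x, f x = y) -> bijective f.
Proof.
move=> inj /choice[g gP]; exists g => // x; exact/inj/gP.
Qed.

Lemma lmod_iso_of (T : pzRingType) (V W : lmodType T) (f : V -> W) :
  linear f -> bijective f -> lmod_iso V W.
Proof. by move=> lf bf; exists (linear_of lf). Qed.

Section Isomorphisms.
Variable T : pzRingType.
Implicit Types U V W : lmodType T.

Lemma lmod_iso_refl V : lmod_iso V V.
Proof. by apply: (@lmod_iso_of _ V V id) => //; exists id. Qed.

Lemma lmod_iso_sym V W : lmod_iso V W -> lmod_iso W V.
Proof.
move=> [f [g fK gK]]; apply: (@lmod_iso_of _ _ _ g); last by exists f.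
by move=> a x y; apply: (can_inj fK); rewrite gK linearP !gK.
Qed.

Lemma lmod_iso_trans V U W : lmod_iso U V -> lmod_iso V W -> lmod_iso U W.
Proof.
move=> [f bf] [g bg]; apply: (@lmod_iso_of _ _ _ (g \o f)); last exact: bij_comp.
by move=> a x y; rewrite /= !linearP.
Qed.

Lemma lmod_iso_prod V V' W W' : lmod_iso V V' -> lmod_iso W W' ->
  lmod_iso (V * W)%type (V' * W')%type.
Proof.
move=> [f [f' fK fK']] [g [g' gK gK']].
apply: (@lmod_iso_of _ (V * W)%type (V' * W')%type (fun u => (f u.1, g u.2))).
  by move=> a x y; rewrite /= !linearP.
exists (fun u => (f' u.1, g' u.2)) => -[x y] /=; first by rewrite fK gK.
by rewrite fK' gK'.
Qed.

Lemma lmod_iso_prodA U V W :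
  lmod_iso (U * (V * W))%type ((U * V) * W)%type.
Proof.
apply: (@lmod_iso_of _ (U * (V * W))%type ((U * V) * W)%type
  (fun u => ((u.1, u.2.1), u.2.2))) => //.
by exists (fun u => (u.1.1, (u.1.2, u.2))) => [[? []]|[[]]].
Qed.

Lemma lmod_iso_prodC V W : lmod_iso (V * W)%type (W * V)%type.
Proof.
apply: (@lmod_iso_of _ (V * W)%type (W * V)%type (fun u => (u.2, u.1))) => //.
by exists (fun u => (u.2, u.1)) => -[].
Qed.

Lemma lmod_iso_ffun0 V W : lmod_iso ({ffun 'I_0 -> V} * W)%type W.
Proof.
apply: (@lmod_iso_of _ ({ffun 'I_0 -> V} * W)%type W (fun u => u.2)) => //.
exists (fun w => (0, w)) => // -[f w]; congr (_, _).
by apply/ffunP => -[].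
Qed.

Lemma lmod_iso_ffunS (n : nat) V :
  lmod_iso {ffun 'I_n.+1 -> V} (V * {ffun 'I_n -> V})%type.
Proof.
apply: (@lmod_iso_of _ {ffun 'I_n.+1 -> V} (V * {ffun 'I_n -> V})%type
    (fun f => (f ord0, [ffun i => f (lift ord0 i)]))).
  move=> a f g; congr (_, _); first by rewrite !ffunE.
  by apply/ffunP => i; rewrite !ffunE.
exists (fun u : V * {ffun 'I_n -> V} =>
    [ffun i => if unlift ord0 i is Some j then u.2 j else u.1]) => [f|[x f]].
  apply/ffunP => i; rewrite ffunE; case: unliftP => [j ->|->] //=.
  by rewrite ffunE.
rewrite /= ffunE unlift_none; congr (_, _).
by apply/ffunP => i; rewrite !ffunE liftK.
Qed.

Lemma direct_summand_prod U V W :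
  direct_summand V W -> direct_summand V (U * W)%type.
Proof.
move=> [V' VW]; exists (U * V')%type.
apply: lmod_iso_trans (lmod_iso_prodA _ _ _) _.
apply: lmod_iso_trans (lmod_iso_prod (lmod_iso_prodC _ _) (lmod_iso_refl _)) _.
apply: lmod_iso_trans (lmod_iso_sym (lmod_iso_prodA _ _ _)) _.
exact: lmod_iso_prod (lmod_iso_refl _) VW.
Qed.

(** Splitting off one N, the hypothesis applies to N^n + L and N^n + M, since P remains a summand of
    N^n + M. This is why it quantifies over all L and M. *)
Lemma cancel_power (N P : lmodType T) (n : nat) :
  (forall L M : lmodType T, direct_summand P M ->
     lmod_iso (N * L)%type (N * M)%type -> lmod_iso L M) ->
  forall L M : lmodType T, direct_summand P M ->
    lmod_iso ({ffun 'I_n -> N} * L)%type ({ffun 'I_n -> N} * M)%type ->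
    lmod_iso L M.
Proof.
move=> cancel; elim: n => [|n IHn] L M PM LM.
  apply: lmod_iso_trans (lmod_iso_sym (lmod_iso_ffun0 N L)) _.
  exact: lmod_iso_trans LM (lmod_iso_ffun0 N M).
apply: IHn => //; apply: cancel; first exact: direct_summand_prod.
have split V : lmod_iso ({ffun 'I_n.+1 -> N} * V)%type
    (N * ({ffun 'I_n -> N} * V))%type.
  apply: lmod_iso_trans (lmod_iso_prod (lmod_iso_ffunS n N) (lmod_iso_refl V)) _.
  exact/lmod_iso_sym/lmod_iso_prodA.
apply: lmod_iso_trans (lmod_iso_sym (split L)) _.
exact: lmod_iso_trans LM (split M).
Qed.

Lemma cancel_summand (N P K : lmodType T) (n : nat) :
  (forall L M : lmodType T, direct_summand P M ->
     lmod_iso (N * L)%type (N * M)%type -> lmod_iso L M) ->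
  direct_summand K {ffun 'I_n -> N} ->
  forall L M : lmodType T, direct_summand P M ->
    lmod_iso (K * L)%type (K * M)%type -> lmod_iso L M.
Proof.
move=> cancel [K' KK'] L M PM LM; apply: (cancel_power (n := n) cancel) => //.
have split V : lmod_iso ({ffun 'I_n -> N} * V)%type (K' * (K * V))%type.
  apply: lmod_iso_trans
    (lmod_iso_prod (lmod_iso_sym KK') (lmod_iso_refl V)) _.
  apply: lmod_iso_trans (lmod_iso_prod (lmod_iso_prodC _ _) (lmod_iso_refl _)) _.
  exact/lmod_iso_sym/lmod_iso_prodA.
apply: lmod_iso_trans (split L) _.
apply: lmod_iso_trans (lmod_iso_prod (lmod_iso_refl _) LM) _.
exact/lmod_iso_sym/split.
Qed.

(* After three elementary automorphisms of N * M, the isomorphism psi becomes  *)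
(* the identity on N, and so induces an isomorphism of the complements.        *)
Lemma unimodular_cancel (N L M : lmodType T)
    (psi : {linear (N * L)%type -> (N * M)%type})
    (h : {linear N -> M}) (g : {linear M -> N}) : bijective psi ->
  (forall n, g ((psi (n, 0)).2 + h (psi (n, 0)).1) = n) -> lmod_iso L M.
Proof.
move=> bpsi gK; pose a n := (psi (n, 0)).1; pose q n := (psi (n, 0)).2 + h (a n).
have psiP c x y : psi (c *: x + y, 0) = c *: psi (x, 0) + psi (y, 0).
  rewrite -linearP; congr (psi _).
  by rewrite -[RHS]/(c *: x + y, c *: 0 + 0) scaler0 addr0.
have aP : linear a by move=> c x y; rewrite /a psiP.
have qP : linear q.
  by move=> c x y; rewrite /q aP linearP psiP /= scalerDr addrACA.
(* On psi (n, 0), [t1] gives (a n, q n); [t2] adds n - a n to the first entry, because g q = 1; [t3]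
   then clears the second. *)
pose t1 (u : (N * M)%type) : (N * M)%type := (u.1, u.2 + h u.1).
pose t2 (u : (N * M)%type) : (N * M)%type := (u.1 + (g u.2 - a (g u.2)), u.2).
pose t3 (u : (N * M)%type) : (N * M)%type := (u.1, u.2 - q u.1).
have b1 : bijective t1.
  by exists (fun u => (u.1, u.2 - h u.1)) => -[x y]; rewrite /t1 /= ?addrK ?subrK.
have b2 : bijective t2.
  by exists (fun u => (u.1 - (g u.2 - a (g u.2)), u.2)) => -[x y];
    rewrite /t2 /= ?addrK ?subrK.
have b3 : bijective t3.
  by exists (fun u => (u.1, u.2 + q u.1)) => -[x y]; rewrite /t3 /= ?addrK ?subrK.
pose theta u := t3 (t2 (t1 (psi u))).
have btheta : bijective theta.
  exact: bij_comp b3 (bij_comp b2 (bij_comp b1 bpsi)).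
have l1 : linear t1.
  move=> c [x y] [x' y']; congr (_, _).
  by rewrite /= linearP scalerDr addrACA.
have l2 : linear t2.
  move=> c [x y] [x' y']; congr (_, _).
  by rewrite /= linearP aP opprD [X in _ + X]addrACA -scalerBr addrACA -scalerDr.
have l3 : linear t3.
  move=> c [x y] [x' y']; congr (_, _).
  by rewrite /= qP opprD addrACA -scalerBr.
have ltheta : linear theta by move=> c x y; rewrite /theta linearP l1 l2 l3.
have theta0 n : theta (n, 0) = (n, 0).
  rewrite /theta /t3 /t2 /t1 /= -/(a n) -/(q n) gK.
  by rewrite addrC subrK subrr.
pose th := linear_of ltheta.
apply: (@lmod_iso_of _ L M (fun l => (theta (0, l)).2)).
  move=> c x y; have := ltheta c (0, x) (0, y) => /(congr1 snd) /= <-.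
  congr (theta _).2.
  by rewrite -[RHS]/(c *: 0 + 0, c *: x + y) scaler0 addr0.
have thB x y : theta (x - y) = theta x - theta y by exact: (raddfB th).
have thD x y : theta (x + y) = theta x + theta y by exact: (raddfD th).
apply: inj_surj_bij => [l l' /= ll'|m].
  have : theta (0, l - l') = theta ((theta (0, l - l')).1, 0).
    rewrite theta0 [LHS]surjective_pairing; congr (_, _).
    have -> : (0, l - l') = (0, l) - (0, l') :> (N * L)%type.
      by rewrite -[RHS]/(0 - 0, l - l') subrr.
    by rewrite thB /= ll' subrr.
  by move=> /(bij_inj btheta)[_ /eqP]; rewrite subr_eq0 => /eqP.
have [th' thK th'K] := btheta; exists (th' (0, m)).2.
have := th'K (0, m); move: (th' _) => [n l] /=.
have -> : (n, l) = (n, 0) + (0, l) 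
  by rewrite -[RHS]/(n + 0, 0 + l) addr0 add0r.
by rewrite thD theta0 => /(congr1 snd) /=; rewrite add0r.
Qed.

End Isomorphisms.

(** * Lifting maps from a localization *)

Section Lifting.
Variables (R : comPzRingType) (S : centralAlgType R) (m : Spec R).

Lemma denMC (s t : den m) : denM s t = denM t s.
Proof. by apply: val_inj; exact: mulrC. Qed.

Lemma common_den (I : finType) (P : I -> den m -> Prop) :
  (forall i, exists s, P i s) -> (forall i s t, P i s -> P i (denM t s)) ->
  exists s, forall i, P i s.
Proof.
move=> exP PM; suff [s sP] : exists s, forall i, i \in enum I -> P i s.
  by exists s => i; apply: sP; rewrite mem_enum.
elim: (enum I) => [|i l [s sP]]; first by exists (den1 m).
have [t tP] := exP i; exists (denM s t) => j.
rewrite inE => /orP[/eqP ->|/sP]; first exact: PM.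
by rewrite denMC; exact: PM.
Qed.

Lemma scale_algM (X : lmodType S^c) (a b : R) (x : X) :
  (alg_map S (a * b) : S^c) *: x = (alg_map S a : S^c) *: ((alg_map S b : S^c) *: x).
Proof. by rewrite scalerA rmorphM; congr (_ *: _); exact: alg_mapC. Qed.

Lemma scale_algC (X : lmodType S^c) (a : R) (c : S^c) (x : X) :
  (alg_map S a : S^c) *: (c *: x) = c *: ((alg_map S a : S^c) *: x).
Proof. exact: (restrZ_linear a c x). Qed.

Definition loc_of (X : lmodType S^c) (x : X) : loc_mod m X := mfrac x (den1 m).

Definition loc_alg (a : S^c) : (loc_ring m S)^c := rfrac (a : S) (den1 m).

Definition loc_den (s : den m) : (loc_ring m S)^c :=
  loc_alg (alg_map S (den_val s) : S^c).

Section LocOf.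
Variable X : lmodType S^c.
Implicit Types x y : X.

Lemma loc_ofD x y : loc_of (x + y) = loc_of x + loc_of y.
Proof.
rewrite /loc_of addr_mfrac; apply: frac_cross.
by rewrite den_valM !den_val1 mul1r !scale1r.
Qed.

Lemma loc_ofZ a x : loc_of (a *: x) = loc_alg a *: loc_of x.
Proof.
rewrite /loc_of -[RHS]/(loc_scale (rfrac (a : S) (den1 m)) _) loc_scale_frac.
by apply: frac_cross; rewrite den_valM den_val1 mul1r.
Qed.

Lemma loc_ofB x y : loc_of (x - y) = loc_of x - loc_of y.
Proof. by apply/eqP; rewrite eq_sym subr_eq -loc_ofD subrK. Qed.

Lemma loc_of0 : loc_of (0 : X) = 0.
Proof. by rewrite -(subrr (0 : X)) loc_ofB subrr. Qed.

Lemma loc_of_sum (I : Type) (r : seq I) (F : I -> X) :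
  loc_of (\sum_(i <- r) F i) = \sum_(i <- r) loc_of (F i).
Proof. exact: (big_morph _ loc_ofD loc_of0). Qed.

Lemma scaler_loc_sum a (I : Type) (r : seq I) (F : I -> loc_mod m X) :
  a *: \sum_(i <- r) F i = \sum_(i <- r) a *: F i.
Proof. exact: (big_morph _ (scalerDr a) (scaler0 _ a)). Qed.

Lemma loc_of_eq0 x : loc_of x = 0 -> exists u : den m,
  den_val u *: (x : restr X) = 0.
Proof.
rewrite -loc_of0 => /frac_eq[u]; rewrite den_val1 !scale1r subr0.
by exists u.
Qed.

Lemma loc_ofP (z : loc_mod m X) : exists s x, loc_of x = loc_den s *: z.
Proof.
have [x [s ->]] := locMP z; exists s, x.
rewrite -[RHS]/(loc_scale (rfrac (alg_map S (den_val s)) (den1 m)) _).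
rewrite loc_scale_frac; apply: frac_cross.
by rewrite den_valM den_val1 mul1r scale1r.
Qed.

Lemma loc_denM s t (z : loc_mod m X) :
  loc_den (denM s t) *: z = loc_den s *: (loc_den t *: z).
Proof.
rewrite scalerA; congr (_ *: _).
rewrite -[RHS]/(rfrac (alg_map S (den_val t)) (den1 m) *
  rfrac (alg_map S (den_val s)) (den1 m)).
rewrite mulr_rfrac -rmorphM mulrC; apply: frac_cross.
by rewrite den_valM den_val1 mul1r.
Qed.

Lemma loc_denC s a (z : loc_mod m X) :
  loc_den s *: (loc_alg a *: z) = loc_alg a *: (loc_den s *: z).
Proof.
rewrite !scalerA; congr (_ *: _).
rewrite -[LHS]/(rfrac (a : S) (den1 m) * rfrac (alg_map S (den_val s)) (den1 m)).
rewrite -[RHS]/(rfrac (alg_map S (den_val s)) (den1 m) * rfrac (a : S) (den1 m)).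
by rewrite !mulr_rfrac alg_mapC.
Qed.

End LocOf.

Section LiftProperty.
Variable X : lmodType S^c.

(** Such maps correspond to the S_m-linear maps F_m -> X_m by restriction to F, so working with them
    avoids constructing maps out of F_m. *)
Definition semilinear (F : lmodType S^c) (th : F -> loc_mod m X) : Prop :=
  (forall x y, th (x + y) = th x + th y) /\
  (forall a x, th (a *: x) = loc_alg a *: th x).

Lemma semilinear0 (F : lmodType S^c) (th : F -> loc_mod m X) :
  semilinear th -> th 0 = 0.
Proof. by move=> [thD _]; apply: (addrI (th 0)); rewrite -thD !addr0. Qed.

Lemma semilinear_sum (F : lmodType S^c) (th : F -> loc_mod m X) (I : Type)
    (r : seq I) (G : I -> F) :
  semilinear th -> th (\sum_(i <- r) G i) = \sum_(i <- r) th (G i).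
Proof. by move=> sth; apply: big_morph; [exact: sth.1|exact: semilinear0]. Qed.

Fact scale_linear (F : lmodType S^c) (r : R) (f : {linear F -> X}) :
  linear (fun x => (alg_map S r : S^c) *: f x).
Proof.
by move=> a x y; rewrite linearP scalerDr scale_algC.
Qed.

(** The images of the generators are lifted over a common denominator s. The finitely many relations
    then hold after multiplication by a further u, and the map descends along the presentation. *)
Lemma lift_finitely_presented (F : lmodType S^c) (th : F -> loc_mod m X) :
  finitely_presented F -> semilinear th ->
  exists s (y : {linear F -> X}), forall z, loc_of (y z) = loc_den s *: th z.
Proof.
move=> [p [q [f [g [gsurj gker]]]]] sth; have [thD thZ] := sth.
have [s sP] : exists s, forall i : 'I_q, exists x : X,
    loc_of x = loc_den s *: th (g (delta_mx 0 i)).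
  apply: common_den => [i|i s t [x xE]]; first exact: loc_ofP.
  exists ((alg_map S (den_val t) : S^c) *: x).
  by rewrite loc_ofZ xE loc_denM.
have /choice[x xP] := sP.
pose y0 (v : 'rV[S^c]_q) := \sum_i v 0 i *: x i.
have y0_lin : linear y0.
  move=> a u v; rewrite /y0 scaler_sumr -big_split; apply: eq_bigr => i _.
  by rewrite !mxE scalerDl scalerA.
have y0P v : loc_of (y0 v) = loc_den s *: th (g v).
  rewrite {2}[v]row_sum_delta linear_sum (semilinear_sum _ _ sth) scaler_loc_sum.
  rewrite [LHS]loc_of_sum.
  by apply: eq_bigr => i _; rewrite loc_ofZ xP linearZ thZ loc_denC.
have [u uP] : exists u : den m, forall k : 'I_p,
    (alg_map S (den_val u) : S^c) *: y0 (f (delta_mx 0 k)) = 0.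
  apply: common_den => [k|k u t uk].
    apply: loc_of_eq0; rewrite y0P (gker _).2 ?semilinear0 ?scaler0 //.
    by exists (delta_mx 0 k).
  by rewrite den_valM scale_algM uk scaler0.
pose y1 := linear_of (scale_linear (den_val u) (linear_of y0_lin)).
have y1f w : y1 (f w) = 0.
  rewrite [w]row_sum_delta !linear_sum big1 // => k _.
  by rewrite linearZ [LHS]linearZ /= uP scaler0.
have y1g v v' : g v = g v' -> y1 v = y1 v'.
  move=> gv; apply/eqP; rewrite -subr_eq0 -linearB.
  have /gker[w <-] : g (v - v') = 0 by rewrite linearB gv subrr.
  by rewrite y1f.
have /choice[sec secP] := gsurj.
have y_lin : linear (fun z => y1 (sec z)).
  by move=> a z z'; rewrite -linearP; apply: y1g; rewrite linearP !secP.
exists (denM u s), (linear_of y_lin) => z /=.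
by rewrite loc_ofZ y0P secP loc_denM.
Qed.

(* Finitely many elements only: an infinite direct sum admits no common        *)
(* denominator.                                                                *)
Definition liftable (F : lmodType S^c) : Prop :=
  forall (th : F -> loc_mod m X) (zs : seq F), semilinear th ->
  exists s (y : {linear F -> X}), forall z, z \in zs ->
    loc_of (y z) = loc_den s *: th z.

Lemma liftable_summand (F G : lmodType S^c) :
  direct_summand F G -> liftable G -> liftable F.
Proof.
move=> [U [f [f' fK f'K]]] liftG th zs sth; have [thD thZ] := sth.
have f'lin : linear f'.
  by move=> a x y; apply: (can_inj fK); rewrite f'K linearP !f'K.
pose io (x : F) := f (x, 0).
have io_lin : linear io.
  move=> a x y; rewrite /io -linearP; congr (f _).
  by rewrite -[RHS]/(a *: x + y, a *: 0 + 0) scaler0 addr0.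
have [|s [y yP]] := liftG (fun x => th (f' x).1) [seq io z | z <- zs].
  have f'D x y : f' (x + y) = f' x + f' y by exact: (raddfD (linear_of f'lin)).
  have f'Z a x : f' (a *: x) = a *: f' x by exact: (linearZ_LR (linear_of f'lin)).
  by split=> [x y|a x]; rewrite ?f'D ?f'Z ?thD ?thZ.
have yio_lin : linear (fun x => y (io x)) by move=> a u v; rewrite io_lin linearP.
exists s, (linear_of yio_lin) => z zzs /=.
by rewrite yP ?map_f // /io fK.
Qed.

End LiftProperty.

Section LiftSum.
Variables (X : lmodType S^c) (I : Type) (F : I -> lmodType S^c).

(** I is an arbitrary type, so equality of indices is decided classically and x is transported along
    it. *)
Definition sum_inj_fun i (x : F i) j : F j :=
  match pselect (i = j) with
  | left e => eq_rect i F x j e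
  | right _ => 0
  end.

Lemma sum_inj_fun_id i (x : F i) : sum_inj_fun x i = x.
Proof.
rewrite /sum_inj_fun; case: pselect => // e.
by rewrite (Prop_irrelevance e erefl).
Qed.

Lemma sum_inj_fun_ne i (x : F i) j : i <> j -> sum_inj_fun x j = 0.
Proof. by rewrite /sum_inj_fun; case: pselect. Qed.

Fact sum_inj_finite i (x : F i) : finite_set [set j | sum_inj_fun x j != 0].
Proof.
apply: (sub_finite_set _ (finite_set1 i)) => j /=.
move=> /eqP nz; apply: contrapT => ij; apply: nz.
by rewrite sum_inj_fun_ne // => e; apply: ij.
Qed.

Definition sum_inj i (x : F i) : dsum F := Dsum (sum_inj_finite x).

Lemma sum_inj_linear i : linear (@sum_inj i).
Proof.
move=> a x y; apply: dsumP => j /=.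
have [e|ne] := pselect (i = j); last by rewrite !sum_inj_fun_ne // scaler0 addr0.
by case: _ / e; rewrite !sum_inj_fun_id.
Qed.

Lemma sum_proj_linear i : linear (fun x : dsum F => x i).
Proof. by []. Qed.

(** The given elements are supported on finitely many summands. The lifts on these are added over
    the product of their denominators and extended by zero elsewhere. *)
Lemma liftable_dsum : (forall i, finitely_presented (F i)) -> liftable X (dsum F).
Proof.
move=> fpF th zs sth; have [thD thZ] := sth.
have sthi i : semilinear (fun x : F i => th (sum_inj x)).
  have injD (x y : F i) : sum_inj (x + y) = sum_inj x + sum_inj y :> dsum F.
    by exact: (raddfD (linear_of (@sum_inj_linear i))).
  have injZ a (x : F i) : sum_inj (a *: x) = a *: sum_inj x :> dsum F.
    by exact: (linearZ_LR (linear_of (@sum_inj_linear i))).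
  by split=> [x y|a x]; rewrite ?injD ?injZ ?thD ?thZ.
have part (l : seq {classic I}) : exists s (y : {linear dsum F -> X}), forall x,
    loc_of (y x) = loc_den s *: \sum_(i <- l) th (sum_inj (x i)).
  elim: l => [|i l [s [y yP]]].
    exists (den1 m), (\0 : {linear dsum F -> X}) => x.
    by rewrite big_nil scaler0 loc_of0.
  have [t [w wP]] := lift_finitely_presented (fpF i) (sthi i).
  pose wi := linear_of (scale_linear (den_val s)
    (w \o linear_of (@sum_proj_linear i) : {linear dsum F -> X})).
  pose yl := linear_of (scale_linear (den_val t) y).
  exists (denM s t), (wi \+ yl : {linear dsum F -> X}) => x.
  rewrite big_cons scalerDr /= loc_ofD !loc_ofZ yP wP.
  by rewrite loc_denM denMC loc_denM.
have [l [ul lP]] : exists l : seq {classic I}, uniq l /\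
    forall z, z \in zs -> forall i, z i != 0 -> i \in l.
  have fin : finite_set (\bigcup_(z in [set z | z \in zs])
      [set i : {classic I} | z i != 0]).
    apply: bigcup_finite; first exact: finite_seq.
    by move=> z _; exact: (@dsum_finite _ _ F).
  have /finite_seqP[l lE] := fin; exists (undup l); rewrite undup_uniq; split=> //.
  move=> z zzs i zi; suff il : i \in l by move: (mem_undup l i); rewrite il.
  suff : [set` l] i by [].
  by rewrite -lE; exists z.
have [s [y yP]] := part l; exists s, y => z zzs; rewrite yP; congr (_ *: _).
rewrite -(semilinear_sum _ _ sth); congr (th _); apply: dsumP => j.
rewrite (big_morph (fun x : dsum F => x j) (id1 := 0) (op1 := +%R)) //.
have [jl|njl] := boolP (j \in l).
  rewrite (bigD1_seq (j : {classic I})) //= sum_inj_fun_id big1 ?addr0 // => i ij.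
  by rewrite sum_inj_fun_ne // => e; move: ij; rewrite e eqxx.
rewrite big1_seq => [|i /andP[_ il]]; last first.
  by rewrite /= sum_inj_fun_ne // => e; move: njl; rewrite -e il.
apply/esym/eqP/negPn/negP => zj; move/negP: njl; apply; exact: lP zj.
Qed.

End LiftSum.
End Lifting.

Arguments loc_den {R S m} s.

(** The rows of Y T have value s at the D selected columns. Adjoining the unit rows of the other c -
    D columns clears the remaining entries and supplies the missing diagonal. *)
Lemma deficient_select (R : comPzRingType) (E : centralAlgType R) (m : Spec R)
    p c D k (T : 'M[E]_(p, c)) (Y : 'M[E]_(D, p)) (f : 'I_D -> 'I_c) s :
  injective f -> ~ spec_set m s -> (c - D <= k)%N ->
  (forall i j, (Y *m T) i (f j) = if i == j then alg_map E s else 0) ->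
  deficient k T m.
Proof.
move=> finj ns ck YT; pose B : {set 'I_c} := ~: [set j in codom f].
have cardB : #|B| = (c - D)%N.
  by rewrite cardsCs finset.setCK cardsE card_codom // !card_ord.
apply: (@deficientW _ _ #|B|); first by rewrite cardB.
pose w (j x : 'I_c) := if [pick i | f i == j] is Some i then - (Y *m T) i x
  else if x == j then alg_map E s else 0.
exists s, (\matrix_(b, j) (enum_val b == j)%:R),
  (\matrix_(j, a) if [pick i | f i == j] is Some i then Y i a else 0),
  (\matrix_(j, b) w j (enum_val b)).
split=> //; apply/matrixP => j j'; rewrite !mxE.
rewrite [X in _ + X](_ : _ = if j' \in B then w j j' else 0); last first.
  transitivity (\sum_(x in B) w j x * (x == j')%:R).
    by rewrite [RHS]big_enum_val; apply: eq_bigr => b _; rewrite !mxE.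
  case: ifP => [Bj'|nBj'].
    rewrite (bigD1 j') //= eqxx mulr1 big1 ?addr0 // => x /andP[_ /negPf ->].
    by rewrite mulr0.
  rewrite big1 // => x Bx; case: eqP => [xj'|_]; last by rewrite mulr0.
  by rewrite -xj' Bx in nBj'.
rewrite /w; case: pickP => [i /eqP fi|nf]; last first.
  rewrite big1 => [|a _]; last first.
    by rewrite mxE; case: pickP => [i|]; rewrite ?nf // mul0r.
  have Bj : j \in B.
    rewrite !inE; apply/negP => /codomP[i ji].
    by have := nf i; rewrite ji eqxx.
  rewrite add0r eq_sym; case: eqP => [<-|_]; first by rewrite Bj.
  by case: ifP.
rewrite (eq_bigr (fun a => Y i a * T a j')) => [|a _]; last first.
  rewrite mxE; case: pickP => [i' /eqP fi'|/(_ i)]; last by rewrite fi eqxx.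
  by rewrite (finj i' i) // fi' fi.
have -> : \sum_a Y i a * T a j' = (Y *m T) i j' by rewrite mxE.
case: ifP => [Bj'|/negbT].
  rewrite subrr; case: eqP => // jj'; move: Bj'.
  by rewrite -jj' -fi !inE codom_f.
rewrite !inE negbK => /codomP[i' ->]; rewrite addr0 YT -fi (inj_eq finj).
by case: eqP.
Qed.

Lemma dim_lt_empty (T : topologicalType) (C : set T) t :
  (forall x, ~ C x) -> dim_lt C t.
Proof.
by move=> C0 Z /chain_top_irr[_ [[x Zx] _]] ZC; apply: (C0 x); exact: ZC.
Qed.

(** * Splittings near a maximal ideal *)

Section LocalSplitting.
Variables (R : comPzRingType) (S : centralAlgType R).
Implicit Types (m : Spec R) (N P M : lmodType S^c).

Lemma finitely_presented_gen N : finitely_presented N ->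
  exists (q : nat) (v : 'I_q -> N), forall x, exists c : 'I_q -> S^c,
    x = \sum_i c i *: v i.
Proof.
move=> [p [q [f [g [gsurj _]]]]]; exists q, (fun i => g (delta_mx 0 i)) => x.
have [w <-] := gsurj x; exists (w 0).
by rewrite {1}[w]row_sum_delta linear_sum; apply: eq_bigr => i _; rewrite linearZ.
Qed.

Lemma not_supp_annihilated m N : finitely_presented N -> ~ Supp (restr N) m ->
  exists s, ~ spec_set m s /\ forall x : N, (alg_map S s : S^c) *: x = 0.
Proof.
move=> /finitely_presented_gen[q [v vP]] nsupp.
have [s sP] : exists s : den m, forall i, (alg_map S (den_val s) : S^c) *: v i = 0.
  apply: common_den => [i|i s t si].
    apply: loc_of_eq0; apply: contrapT => nz; apply: nsupp.
    by exists (loc_of m (v i)); apply/eqP.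
  by rewrite den_valM scale_algM si scaler0.
exists (den_val s); split=> [|x]; first exact: denP.
have [c ->] := vP x; rewrite scaler_sumr big1 // => i _.
by rewrite scale_algC sP scaler0.
Qed.

Definition split_at m (D : nat) N M s : Prop := ~ spec_set m s /\
  exists (x : 'I_D -> {linear N -> M}) (y : 'I_D -> {linear M -> N}),
  forall i j n, y i (x j n) = if i == j then (alg_map S s : S^c) *: n else 0.

(** The D inclusions of N_m and the D projections back are lifted up to denominators, the latter
    only on the images of generators of N. Their composites are then correct in N_m on these
    generators, and one more denominator u makes them correct in N. *)
Lemma local_split m D N P : finitely_presented N -> liftable m N P ->
  direct_summand {ffun 'I_D -> loc_mod m N} (loc_mod m P) ->
  exists s, split_at m D N P s.
Proof.
move=> fpN liftP [U [f [f' fK f'K]]].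
have f'lin : linear f'.
  by move=> a z w; apply: (can_inj fK); rewrite f'K linearP !f'K.
have f'Z a z : f' (a *: z) = a *: f' z by exact: (linearZ_LR (linear_of f'lin)).
have f'D z w : f' (z + w) = f' z + f' w by exact: (raddfD (linear_of f'lin)).
pose del (j : 'I_D) (z : loc_mod m N) : {ffun 'I_D -> loc_mod m N} :=
  [ffun i => if i == j then z else 0].
pose th j (n : N) := f (del j (loc_of m n), 0).
have sth j : semilinear (th j).
  split=> [n n'|a n].
    rewrite /th -[RHS]raddfD; congr (f (_, _)); last by rewrite addr0.
    by apply/ffunP => i; rewrite !ffunE loc_ofD; case: eqP; rewrite ?addr0.
  rewrite /th -[RHS]linearZ_LR; congr (f (_, _)); last by rewrite scaler0.
  by apply/ffunP => i; rewrite !ffunE loc_ofZ; case: eqP; rewrite ?scaler0.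
have [s sP] : exists s, forall j, exists x : {linear N -> P},
    forall n, loc_of m (x n) = loc_den s *: th j n.
  apply: common_den => [j|j s t [x xP]].
    exact: lift_finitely_presented.
  exists (linear_of (scale_linear (den_val t) x)) => n.
  by rewrite /= loc_ofZ xP loc_denM.
have /choice[x xP] := sP.
have [q [v vP]] := finitely_presented_gen fpN.
pose th' (i : 'I_D) (z : P) := (f' (loc_of m z)).1 i.
have sth' i : semilinear (th' i).
  by split=> [z w|a z]; rewrite /th' ?loc_ofD ?loc_ofZ ?f'D ?f'Z /= ffunE.
pose zs := [seq x u.1 (v u.2) | u <- enum {: 'I_D * 'I_q}].
have [t tP] : exists t, forall i, exists y : {linear P -> N},
    forall z, z \in zs -> loc_of m (y z) = loc_den t *: th' i z.
  apply: common_den => [i|i t u [y yP]]; first exact: liftP.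
  exists (linear_of (scale_linear (den_val u) y)) => z zzs.
  by rewrite /= loc_ofZ yP // loc_denM.
have /choice[y yP] := tP.
pose r := den_val (denM t s).
have [u uP] : exists u : den m, forall ijk : 'I_D * 'I_D * 'I_q,
    (alg_map S (den_val u) : S^c) *: (y ijk.1.1 (x ijk.1.2 (v ijk.2)) -
      if ijk.1.1 == ijk.1.2 then (alg_map S r : S^c) *: v ijk.2 else 0) = 0.
  apply: common_den => [[[i j] k] /=|ijk u w uw].
    apply: loc_of_eq0; rewrite loc_ofB yP; last first.
      by apply/mapP; exists (j, k); rewrite ?mem_enum.
    rewrite /th' xP f'Z fK /= !ffunE -loc_denM.
    by case: eqP => _; rewrite ?loc_ofZ ?loc_of0 ?scaler0 subrr.
  by rewrite den_valM scale_algM uw scaler0.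
exists (den_val (denM u (denM t s))); split; first exact: denP.
exists x, (fun i => linear_of (scale_linear (den_val u) (y i))) => i j n /=.
have [c ->] := vP n; pose F : {linear N -> N} :=
  linear_of (scale_linear (den_val u) (y i)) \o x j.
have Fv k : F (v k) = (alg_map S (den_val u) : S^c) *:
    if i == j then (alg_map S r : S^c) *: v k else 0.
  by apply/eqP; rewrite -subr_eq0 -scalerBr; apply/eqP; exact: (uP (i, j, k)).
rewrite -[LHS]/(F _) linear_sum.
have [ij|nij] := eqVneq i j; last first.
  rewrite big1 // => k _.
  by rewrite linearZ_LR Fv (negPf nij) !scaler0.
rewrite scaler_sumr; apply: eq_bigr => k _; rewrite linearZ_LR Fv ij eqxx.
by rewrite -(scale_algC _ (c k)) -(scale_algC r) -scale_algM.
Qed.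

End LocalSplitting.

(** * Global cancellation *)

Section Cancellation.
Variables (R : comPzRingType) (S : centralAlgType R).
Implicit Types (L M N P : lmodType S^c).

Definition comp_endo N M (g : {linear M -> N}) (x : {linear N -> M}) : endo N :=
  Endo (linearP (g \o x : {linear N -> N})).

Lemma endo_sumE N (I : Type) (r : seq I) (F : I -> endo N) x :
  (\sum_(i <- r) F i) x = \sum_(i <- r) F i x.
Proof. exact: (big_morph (fun f : endo N => f x) (id1 := 0) (op1 := +%R)). Qed.

Lemma summand_maps (T : pzRingType) (V W : lmodType T) : direct_summand V W ->
  exists (io : {linear V -> W}) (pr : {linear W -> V}), forall x, pr (io x) = x.
Proof.
move=> [U [f [f' fK f'K]]].
have f'lin : linear f'.
  by move=> a z w; apply: (can_inj fK); rewrite f'K linearP !f'K.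
have io_lin : linear (fun x => f (x, 0)).
  move=> a x y; rewrite -linearP; congr (f _).
  by rewrite -[RHS]/(a *: x + y, a *: 0 + 0) scaler0 addr0.
have pr_lin : linear (fun w => (f' w).1) by move=> a x y; rewrite f'lin.
by exists (linear_of io_lin), (linear_of pr_lin) => x /=; rewrite fK.
Qed.

Lemma split_at_summand m D N P M s :
  direct_summand P M -> split_at m D N P s -> split_at m D N M s.
Proof.
move=> /summand_maps[io [pr prK]] [ns [x [y yx]]]; split=> //.
exists (fun j => io \o x j : {linear N -> M}), (fun i => y i \o pr : {linear M -> N}).
by move=> i j n /=; rewrite prK.
Qed.

Theorem cancel_endo_finite (D : nat) N L M :
  let Y := @Max R `&` Supp (restr N) in
  noetherian_space (set_type Y) -> dim_lt [set: set_type Y] D ->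
  finitely_presented N -> module_finite (End_alg N) ->
  (forall m, Y m -> exists s, split_at m D N M s) ->
  lmod_iso (N * L)%type (N * M)%type -> lmod_iso L M.
Proof.
move=> Y noethY dimY fpN finE splitY [psi [psi' psiK psi'K]].
pose E := End_alg N.
have Ymax : Y `<=` @Max R by move=> m [].
have Ycover m : Max m -> ~ Y m -> exists s, ~ spec_set m s /\ alg_map E s = 0.
  move=> maxm nYm; have [|s [ns sN]] := @not_supp_annihilated _ _ m N fpN.
    by move=> suppm; apply: nYm.
  exists s; split=> //; apply: endoP => x; exact: sN.
have split_max m : Max m -> exists s, split_at m D N M s.
  move=> maxm; have [Ym|nYm] := pselect (Y m); first exact: splitY.
  have [|s [ns sN]] := @not_supp_annihilated _ _ m N fpN.
    by move=> suppm; apply: nYm.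
  (* Off Y some s outside m annihilates N, so zero maps are already a splitting. *)
  exists s; split=> //; exists (fun=> \0), (fun=> \0) => i j n /=.
  by rewrite sN if_same.
pose good s := exists (x : 'I_D -> {linear N -> M}) (y : 'I_D -> {linear M -> N}),
  forall i j n, y i (x j n) = if i == j then (alg_map S s : S^c) *: n else 0.
pose J : set R := [set r | exists l : seq (R * R),
  (forall u, u \in l -> good u.2) /\ r = \sum_(u <- l) u.1 * u.2].
have [l [lgood oneE]] : J 1.
  apply: ideal_not_in_max => [|m /split_max[s [ns gs]]].
    split=> [|r r' [l [lg ->]] [l' [lg' ->]]|r r' [l [lg ->]]].
    - by exists [::]; rewrite big_nil.
    - exists (l ++ l'); rewrite big_cat; split=> // u.
      by rewrite mem_cat => /orP[/lg|/lg'].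
    - exists [seq (r * u.1, u.2) | u <- l]; split=> [u /mapP[w /lg gw ->] //|].
      by rewrite big_map mulr_sumr; apply: eq_bigr => u _; rewrite mulrA.
  exists s; split=> //; exists [:: (1, s)]; rewrite big_seq1 mul1r; split=> // u.
  by rewrite inE => /eqP ->.
have /choice[xy xyP] (k : 'I_(size l)) : exists xy :
    ('I_D -> {linear N -> M}) * ('I_D -> {linear M -> N}), forall i j n,
    xy.2 i (xy.1 j n) =
      if i == j then (alg_map S (nth (0, 0) l k).2 : S^c) *: n else 0.
  have [x [y yx]] := lgood _ (mem_nth (0, 0) (ltn_ord k)).
  by exists (x, y).
pose n := #|{: 'I_(size l) * 'I_D}|.
pose x (j : 'I_n) := let u := enum_val j in (xy u.1).1 u.2.
pose y (j : 'I_n) := let u := enum_val j in (xy u.1).2 u.2.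
have psi'lin : linear psi'.
  by move=> a z w; apply: (can_inj psiK); rewrite psi'K linearP !psi'K.
have q_lin : linear (fun z => (psi (z, 0)).2).
  move=> a z w; rewrite -[RHS]/((a *: psi (z, 0) + psi (w, 0)).2) -linearP.
  by congr (psi _).2; rewrite -[RHS]/(a *: z + w, a *: 0 + 0) scaler0 addr0.
have a_lin : linear (fun z => (psi (z, 0)).1).
  move=> a z w; rewrite -[RHS]/((a *: psi (z, 0) + psi (w, 0)).1) -linearP.
  by congr (psi _).1; rewrite -[RHS]/(a *: z + w, a *: 0 + 0) scaler0 addr0.
have r_lin : linear (fun z => (psi' (0, z)).1).
  move=> a z w; rewrite -[RHS]/((a *: psi' (0, z) + psi' (0, w)).1) -psi'lin.
  by congr (psi' _).1; rewrite -[RHS]/(a *: 0 + 0, a *: z + w) scaler0 addr0.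
have b_lin : linear (fun z => (psi' (z, 0)).1).
  move=> a z w; rewrite -[RHS]/((a *: psi' (z, 0) + psi' (w, 0)).1) -psi'lin.
  by congr (psi' _).1; rewrite -[RHS]/(a *: z + w, a *: 0 + 0) scaler0 addr0.
pose q := linear_of q_lin; pose r := linear_of r_lin.
pose a : E := Endo a_lin; pose b : E := Endo b_lin.
(* The extra row r is adjoined so that b a + rho v = 1 holds with rho = (0, ..., 0, 1). *)
pose g (i : 'I_(n + 1)) := match fintype.split i with inl j => y j | inr _ => r end.
have g_l j : g (lshift 1 j) = y j by rewrite /g (unsplitK (inl _)).
have g_r j : g (rshift n j) = r by rewrite /g (unsplitK (inr _)).
pose X : 'M[E]_(n + 1, n) := \matrix_(i, j) comp_endo (g i) (x j).
pose v : 'cV[E]_(n + 1) := \col_i comp_endo (g i) q.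
have bav : b%:M *m a%:M + row_mx 0 1%:M *m v = 1%:M.
  rewrite -[v]vsubmxK mul_row_col mul0mx add0r mul1mx -scalar_mxM.
  apply/matrixP => i j; rewrite !ord1 !mxE eqxx !mulr1n.
  apply: endoP => z; rewrite g_r /=.
  have -> : (psi' ((psi (z, 0)).1, 0)).1 + (psi' (0, (psi (z, 0)).2)).1 =
      (psi' (psi (z, 0))).1.
    rewrite -[LHS]/((_ + _).1) -(raddfD (linear_of psi'lin)) /=.
    congr (psi' _).1; rewrite -[LHS]/(_ + 0, 0 + _) addr0 add0r.
    exact/esym/surjective_pairing.
  by rewrite psiK.
have [k kn|e [rho er]] := stable_columns finE Ymax noethY Ycover
    (X := X) (v := v) bav.
  (* Either the bound on dim Y suffices, or k >= n + 1 - D and the D split columns of an s outside m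
     make the locus empty. *)
  have [Dnk|nkD] := leqP D (n - k).
    apply: (dim_ltW Dnk) => Z tZ _; exact: dimY tZ _.
  apply: dim_lt_empty => m /=; apply.
  have [t nt] : exists t : 'I_(size l),
      ~ spec_set (set_val m) (nth (0, 0) l t).2.
    apply: contrapT => nt; apply: (@spec_proper _ (set_val m)); rewrite oneE.
    have [m0 mD mM] := spec_ideal (set_val m).
    rewrite big_seq; apply: big_ind => // u ul; apply: mM.
    apply: contrapT => nu; apply: nt.
    have ku : (index u l < size l)%N by rewrite index_mem.
    by exists (Ordinal ku); rewrite /= nth_index.
  pose f (i : 'I_D) : 'I_(n + 1) := lshift 1 (enum_rank (t, i)).
  pose Ysel : 'M[E]_(D, n + 1) := \matrix_(i, j) (j == f i)%:R.
  apply: (@deficient_select _ _ _ _ _ D _ _ Ysel f) nt _ _.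
  - by move=> i j /lshift_inj/enum_rank_inj[].
  - by rewrite leq_subLR addn1 -{1}(subnK kn) -addSn leq_add2r.
  - move=> i j; rewrite mxE (bigD1 (f i)) //= big1 ?addr0 => [|i' /negPf fi'].
      rewrite mxE eqxx mul1r row_mxEl mxE g_l; apply: endoP => z /=.
      by rewrite /x /y !enum_rankK xyP; case: eqP.
    by rewrite mxE fi' mul0r.
pose hf z := \sum_j x j (e j 0 z).
pose gf z := \sum_i rho 0 i (g i z).
have h_lin : linear hf.
  move=> c z w; rewrite /hf scaler_sumr -big_split; apply: eq_bigr => j _.
  by rewrite !linearP.
have g_lin : linear gf.
  move=> c z w; rewrite /gf scaler_sumr -big_split; apply: eq_bigr => i _.
  by rewrite !linearP.
apply: (@unimodular_cancel _ N L M psi (linear_of h_lin) (linear_of g_lin)).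
  by exists psi'.
move=> z; have := congr1 (fun A : 'M[E]_1 => (A 0 0 : endo N) z) er.
rewrite !mxE eqxx mulr1n /= endo_sumE => sumE; rewrite -[RHS]sumE.
apply: eq_bigr => i _; rewrite -[RHS]/(rho 0 i ((v + X *m (e *m a%:M)) i 0 z)).
congr (rho 0 i _); rewrite !mxE /= endo_sumE raddfD raddf_sum; congr (_ + _).
apply: eq_bigr => j _; rewrite !mxE big_ord1 mxE eqxx mulr1n; reflexivity.
Qed.

End Cancellation.

Theorem corollary6p4 (R : comPzRingType) (S : centralAlgType R)
    (K L M N P : lmodType S^c) :
  let E : centralAlgType R := End_alg N in
  let Y : set (Spec R) := @Max R `&` Supp (restr N) in
  noetherian_space (set_type Y) -> finite_dimensional (set_type Y) ->
  finitely_presented N -> module_finite E ->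
  (exists (I : Type) (F : I -> lmodType S^c),
     (forall i, finitely_presented (F i)) /\ direct_summand P (dsum F)) ->
  direct_summand P M ->
  (forall m : Spec R, Y m ->
     direct_summand {ffun 'I_(1 + krull_dim (set_type Y)) -> loc_mod m N}
                    (loc_mod m P)) ->
  (lmod_iso (N * L)%type (N * M)%type -> lmod_iso L M) /\
  ((exists n : nat, direct_summand K {ffun 'I_n -> N}) ->
   lmod_iso (K * L)%type (K * M)%type -> lmod_iso L M).
Proof.
move=> E Y noethY dimY fpN finE [I [F [fpF PF]]] PM NP.
(* General L' and M' are needed because [cancel_summand] applies this to sums of copies of N with L
   and M. *)
have cancel (L' M' : lmodType S^c) : direct_summand P M' ->
    lmod_iso (N * L')%type (N * M')%type -> lmod_iso L' M'.
  move=> PM'; apply: (cancel_endo_finite noethY (dim_ltT dimY) fpN finE) => m Ym.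
  have liftP := liftable_summand PF (liftable_dsum (m := m) (X := N) fpF).
  have [s sP] := local_split fpN liftP (NP m Ym).
  by exists s; exact: split_at_summand sP.
split; first exact: cancel.
by move=> [n KN]; exact: cancel_summand cancel KN _ _ PM.
Qed.
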